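(* Let $\mathfrak a,\mathfrak b,\mathfrak c$ be $C^*$-bases, $\mathcal A=A^{\alpha,\beta}_H$ a $C^*$-$(\mathfrak a^\dagger,\mathfrak b)$-algebra and $\mathcal B=B^{\gamma,\delta}_K$ a $C^*$-$(\mathfrak b^\dagger,\mathfrak c)$-algebra. Then $\mathcal A*_{\mathfrak b}\mathcal B:=({}_\alpha H_\beta\otimes_{\mathfrak b}{}_\gamma K_\delta,\ A*_{\mathfrak b}B)$ is a $C^*$-$(\mathfrak a^\dagger,\mathfrak c)$-algebra.
   Context: Notation: $[Y]$ is the closed linear span of a subset $Y$ of a normed space; for sets of operators, $XY=\{xy\}$, $X^*=\{x^*\}$, and $X'$ is the commutant. A $C^*$-base $\mathfrak b=(\mathfrak K,\mathfrak B,\mathfrak B^\dagger)$ consists of a Hilbert space $\mathfrak K$ and two nondegenerate $C^*$-algebras $\mathfrak B,\mathfrak B^\dagger\subseteq\mathcal L(\mathfrak K)$ that commute elementwise; its opposite is $\mathfrak b^\dagger=(\mathfrak K,\mathfrak B^\dagger,\mathfrak B)$. Write $\mathfrak a=(\mathfrak H,\mathfrak A,\mathfrak A^\dagger)$, $\mathfrak c=(\mathfrak L,\mathfrak C,\mathfrak C^\dagger)$. A $C^*$-$\mathfrak b$-module $H_\beta=(H,\beta)$ is a Hilbert space $H$ with a closed subspace $\beta\subseteq\mathcal L(\mathfrak K,H)$ such that $[\beta\mathfrak K]=H$, $[\beta\mathfrak B]=\beta$, $[\beta^*\beta]=\mathfrak B$. There is a unique normal unital faithful representation $\rho_\beta:\mathfrak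 B'\to\mathcal L(H)$ with $\rho_\beta(x)\xi\zeta=\xi x\zeta$ for $x\in\mathfrak B'$, $\xi\in\beta$, $\zeta\in\mathfrak K$. A $C^*$-$(\mathfrak a^\dagger,\mathfrak b)$-module ${}_\alpha H_\beta=(H,\alpha,\beta)$ is a Hilbert space $H$ such that $(H,\alpha)$ is a $C^*$-$\mathfrak a^\dagger$-module, $(H,\beta)$ is a $C^*$-$\mathfrak b$-module, $[\rho_\alpha(\mathfrak A)\beta]=\beta$ and $[\rho_\beta(\mathfrak B^\dagger)\alpha]=\alpha$. A $C^*$-$(\mathfrak a^\dagger,\mathfrak b)$-algebra $A^{\alpha,\beta}_H=({}_\alpha H_\beta,A)$ is a $C^*$-$(\mathfrak a^\dagger,\mathfrak b)$-module ${}_\alpha H_\beta$ with a (possibly degenerate) $C^*$-algebra $A\subseteq\mathcal L(H)$ such that $\rho_\alpha(\mathfrak A)A\subseteq A$ and $\rho_\beta(\mathfrak B^\dagger)A\subseteq A$. Relative tensor product: for a $C^*$-$\mathfrak b$-module $H_\beta$ and a $C^*$-$\mathfrak b^\dagger$-module $K_\gamma$, $H\otimes_{\mathfrak b}K$ is the Hilbert space obtained as separated completion of $\beta\odot\mathfrak K\odot\gamma$ with respect to $\langle\xi\odot\zeta\odot\eta|\xi'\odot\zeta'\odot\eta'\rangle=\langle\zeta|\xi^*\xi'\eta^*\eta'\zeta'\rangle$, with elementary tensors $\xi\otimes\zeta\otimes\eta$. For $\xi\in\beta$, $\eta\in\gamma$ there are bounded operators $|\xi\rangle_1:K\to H\otimes_{\mathfrak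 b}K$, $\eta\zeta\mapsto\xi\otimes\zeta\otimes\eta$, and $|\eta\rangle_2:H\to H\otimes_{\mathfrak b}K$, $\xi\zeta\mapsto\xi\otimes\zeta\otimes\eta$; $|\beta\rangle_1=\{|\xi\rangle_1:\xi\in\beta\}$, $|\gamma\rangle_2=\{|\eta\rangle_2:\eta\in\gamma\}$. The $C^*$-$(\mathfrak a^\dagger,\mathfrak c)$-module ${}_\alpha H_\beta\otimes_{\mathfrak b}{}_\gamma K_\delta$ is $(H\otimes_{\mathfrak b}K,\ [|\gamma\rangle_2\alpha],\ [|\beta\rangle_1\delta])$. Fiber product: $A*_{\mathfrak b}B$ is the $C^*$-algebra of all $T\in\mathcal L(H\otimes_{\mathfrak b}K)$ such that $T|\gamma\rangle_2+T^*|\gamma\rangle_2\subseteq[|\gamma\rangle_2A]$ and $T|\beta\rangle_1+T^*|\beta\rangle_1\subseteq[|\beta\rangle_1B]$. *)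

(* Defs.v *)
From HB Require Import structures.
From mathcomp Require Import all_boot all_order all_algebra.
From mathcomp Require Import sesquilinear complex.
From mathcomp Require Import boolp classical_sets functions reals.
From mathcomp Require Import topology normedtype.
Set Implicit Arguments.
Unset Strict Implicit.
Unset Printing Implicit Defensive.
Import Order.TTheory GRing.Theory Num.Theory.
Import numFieldNormedType.Exports.
Local Open Scope classical_set_scope.
Local Open Scope ring_scope.
Local Open Scope complex_scope.

HB.mixin Record isHilbert (R : realType) T of CompleteNormedModule R[i] T := {
  hdot : {dot T for (@Num.conj R[i])} ;
  normr_hdot : forall x : T, `|x| ^+ 2 = hdot x x
}.

#[short(type="hilbertType")]
HB.structure Definition Hilbert (R : realType) :=
  {T of isHilbert R T & CompleteNormedModule R[i] T}.

(* [{dot _ for conj}] is linear in its first argument, whereas the inner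
   products <x|y> used here are linear in the second one. *)
Definition inner (R : realType) (H : hilbertType R) (x y : H) : R[i] :=
  hdot y x.

Section Operators.
Context {R : realType}.
Implicit Types H K L : hilbertType R.

Definition bounded_op {H K} : set (H -> K) :=
  [set T | linear T /\ exists M : R[i], forall x, `|T x| <= M * `|x|].

Definition adjoint {H K} (T : H -> K) : K -> H :=
  xget 0 [set S | bounded_op S /\ forall x y, inner (T x) y = inner x (S y)].

Definition lin_span {V : lmodType R[i]} (Y : set V) : set V :=
  [set v | exists n (a : 'I_n -> R[i]) (y : 'I_n -> V),
    (forall i, Y (y i)) /\ v = \sum_(i < n) a i *: y i].

Definition closed_span {H} (Y : set H) : set H := closure (lin_span Y).

(* Closure in L(H,K) for the operator norm: the last clause of the definition
   says that the operator norm of [T - S] is at most [e]. *)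
Definition op_closure {H K} (Y : set (H -> K)) : set (H -> K) :=
  [set T | bounded_op T /\ forall e : R[i], 0 < e ->
    exists2 S, Y S & forall x, `|T x - S x| <= e * `|x|].

Definition op_closed_span {H K} (Y : set (H -> K)) : set (H -> K) :=
  op_closure (lin_span Y).

Definition op_closed_subspace {H K} (V : set (H -> K)) : Prop :=
  [/\ V `<=` bounded_op, V 0,
      forall (a : R[i]) S T, V S -> V T -> V (a *: S + T)
    & op_closure V `<=` V].

Definition op_mul {H K L} (X : set (K -> L)) (Y : set (H -> K)) :
  set (H -> L) := [set S \o T | S in X & T in Y].

Definition op_apply {H K} (X : set (H -> K)) : set K :=
  [set T z | T in X & z in [set: H]].

Definition op_adjoint {H K} (X : set (H -> K)) : set (K -> H) :=
  adjoint @` X.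

Definition cstar_algebra {H} (A : set (H -> H)) : Prop :=
  [/\ op_closed_subspace A, op_mul A A `<=` A & op_adjoint A `<=` A].

Definition nondegenerate {H} (A : set (H -> H)) : Prop :=
  closed_span (op_apply A) = setT.

End Operators.

Record cbase (R : realType) := CBase {
  cb_space : hilbertType R ;
  cb_alg : set (cb_space -> cb_space) ;
  cb_dag : set (cb_space -> cb_space) ;
  cb_algP : cstar_algebra cb_alg /\ nondegenerate cb_alg ;
  cb_dagP : cstar_algebra cb_dag /\ nondegenerate cb_dag ;
  cb_comm : forall x y, cb_alg x -> cb_dag y -> x \o y = y \o x
}.

Arguments cb_alg {R} b _ : rename.
Arguments cb_dag {R} b _ : rename.

Definition cb_op (R : realType) (b : cbase R) : cbase R :=
  CBase (cb_dagP b) (cb_algP b)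
    (fun x y bx by_ => esym (cb_comm by_ bx)).

Section Modules.
Context {R : realType}.
Implicit Types (a b c : cbase R) (H K : hilbertType R).

Definition cmodule b H (beta : set (cb_space b -> H)) : Prop :=
  [/\ op_closed_subspace beta,
      closed_span (op_apply beta) = setT,
      op_closed_span (op_mul beta (cb_alg b)) = beta
    & op_closed_span (op_mul (op_adjoint beta) beta) = cb_alg b].

(* rho_beta(x), meaningful when [beta] is a C*-b-module and [x] is in the
   commutant of [cb_alg b]. *)
Definition rho b H (beta : set (cb_space b -> H))
    (x : cb_space b -> cb_space b) : H -> H :=
  xget 0 [set S | bounded_op S /\
    forall xi z, beta xi -> S (xi z) = xi (x z)].

Arguments cmodule b {H} beta.
Arguments rho b {H} beta x.

(* C*-(a^dagger, b)-modules: the first base is given by [a], not by its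
   opposite. *)
Definition cbimodule a b H (alpha : set (cb_space a -> H))
    (beta : set (cb_space b -> H)) : Prop :=
  [/\ cmodule (cb_op a) alpha, cmodule b beta,
      op_closed_span (op_mul (rho (cb_op a) alpha @` cb_alg a) beta) = beta
    & op_closed_span (op_mul (rho b beta @` cb_dag b) alpha) = alpha].

Arguments cbimodule a b {H} alpha beta.

Definition cbialgebra a b H (alpha : set (cb_space a -> H))
    (beta : set (cb_space b -> H)) (A : set (H -> H)) : Prop :=
  [/\ cbimodule a b alpha beta, cstar_algebra A,
      op_mul (rho (cb_op a) alpha @` cb_alg a) A `<=` A
    & op_mul (rho b beta @` cb_dag b) A `<=` A].

Arguments cbialgebra a b {H} alpha beta A.

(* The separated completion of the algebraic tensor product of [beta],
   [cb_space b] and [gamma], i.e. a Hilbert space with a map on elementary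
   tensors that has dense linear span and satisfies the formula for the inner
   product. By sesquilinearity, that formula on elementary tensors amounts to
   [tens] inducing a linear isometry, modulo null vectors, on the whole
   algebraic tensor product. The values of [tens] outside of [beta] and
   [gamma] are irrelevant. *)
Record rel_tensor b H K (beta : set (cb_space b -> H))
    (gamma : set (cb_space b -> K)) := RelTensor {
  rt_space : hilbertType R ;
  tens : (cb_space b -> H) -> cb_space b -> (cb_space b -> K) -> rt_space ;
  inner_tens : forall xi xi' z z' eta eta',
    beta xi -> beta xi' -> gamma eta -> gamma eta' ->
    inner (tens xi z eta) (tens xi' z' eta') =
    inner z (adjoint xi (xi' (adjoint eta (eta' z')))) ;
  tens_dense : closed_span
    [set v | exists xi z eta, [/\ beta xi, gamma eta & v = tens xi z eta]] =
    setT
}.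

Arguments rel_tensor b {H K} beta gamma.

Section RelativeTensor.
Context {b : cbase R} {H K : hilbertType R}.
Context {beta : set (cb_space b -> H)} {gamma : set (cb_space b -> K)}.
Variable E : rel_tensor b beta gamma.

Definition ket1 (xi : cb_space b -> H) : K -> rt_space E :=
  xget 0 [set S | bounded_op S /\
    forall eta z, gamma eta -> S (eta z) = tens E xi z eta].

Definition ket2 (eta : cb_space b -> K) : H -> rt_space E :=
  xget 0 [set S | bounded_op S /\
    forall xi z, beta xi -> S (xi z) = tens E xi z eta].

Definition left_leg a (alpha : set (cb_space a -> H)) :
    set (cb_space a -> rt_space E) :=
  op_closed_span (op_mul (ket2 @` gamma) alpha).

Definition right_leg c (delta : set (cb_space c -> K)) :
    set (cb_space c -> rt_space E) :=
  op_closed_span (op_mul (ket1 @` beta) delta).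

Definition fiber_product (A : set (H -> H)) (B : set (K -> K)) :
    set (rt_space E -> rt_space E) :=
  [set T | [/\ bounded_op T,
    [set (T \o X) + (adjoint T \o Y)
      | X in ket2 @` gamma & Y in ket2 @` gamma]
      `<=` op_closed_span (op_mul (ket2 @` gamma) A)
  & [set (T \o X) + (adjoint T \o Y)
      | X in ket1 @` beta & Y in ket1 @` beta]
      `<=` op_closed_span (op_mul (ket1 @` beta) B)]].

End RelativeTensor.
End Modules.

Arguments cmodule {R} b {H} beta.
Arguments rho {R} b {H} beta x.
Arguments cbimodule {R} a b {H} alpha beta.
Arguments cbialgebra {R} a b {H} alpha beta A.
Arguments rel_tensor {R} b {H K} beta gamma.
Arguments left_leg {R b H K beta gamma} E {a} alpha.
Arguments right_leg {R b H K beta gamma} E {c} delta.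
Arguments fiber_product {R b H K beta gamma} E A B _.

(* Main.v *)
(** With P = rho(x) acting on the left leg, P |eta>_2 = |eta>_2 rho_alpha(x) and
P |xi>_1 = |rho_alpha(x) xi>_1, that is, P is rho_alpha(x) (x) 1; together with
|eta>_2^* |eta'>_2 = rho_beta(eta^* eta') these relations give all the
inclusions, since products of closed spans are controlled on generators. The
right leg is the left leg of the flipped tensor product.

The operators rho(x) and |eta>_2 extend from the span of the vectors xi z. For
h = x^* x the numbers a_k = |sum_i xi_i h^k z_i| are log-convex, because h
commutes with all xi^* xi', and a_k <= C |x|^(2k); hence a_1 <= |x|^2 a_0, which
bounds rho(x) without functional calculus. *)
Require Import Defs.
From mathcomp Require Import all_boot all_order all_algebra.
From mathcomp Require Import sesquilinear complex.
From mathcomp Require Import boolp classical_sets functions reals.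
From mathcomp Require Import topology normedtype.
From mathcomp Require Import ring lra.
Set Implicit Arguments.
Unset Strict Implicit.
Unset Printing Implicit Defensive.
Import Order.TTheory GRing.Theory Num.Theory.
Import numFieldNormedType.Exports.
Local Open Scope classical_set_scope.
Local Open Scope ring_scope.
Local Open Scope complex_scope.

Local Notation Re := complex.Re.
Local Notation Im := complex.Im.

(** * Inner products and operators on Hilbert spaces *)

Section RealNorm.
Context {R : realType}.
Implicit Types H K : hilbertType R.

(** [adjoint], [rho], [ket1] and [ket2] are picked by [xget], so each calls for a bounded operator
    with prescribed values on generators, unique by density. An assignment such as
    [xi z |-> xi (x z)] is not known to be well defined before it is bounded; hence Riesz
    representation and extension are proved for linear relations, and the bound on a relation is
    what makes it single valued. The same list of generators, evaluated in two ways, yields that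
    bound. Reduction to generators rests on one principle, [op_preimage_subspace]: the preimage of a
    norm-closed subspace under a bounded linear or conjugate-linear map is again one. The map is
    composition with a fixed operator, [adjoint], [rho] or [ket1]. For the last two this takes norm
    control as well as existence, and for this reason the extensions carry their bounds along. *)

Definition nrm {H} (x : H) : R := Re `|x|.

(** Norms and inner products live in [R[i]]; their real parts move all estimates to the ordered
    field [R], where [lra] applies. *)
Definition rdot {H} (x y : H) : R := Re (inner x y).

Lemma normE {H} (x : H) : `|x| = (nrm x)%:C.
Proof. by rewrite /nrm RRe_real// ger0_real. Qed.

Lemma innerPr {H} (x y z : H) (a : R[i]) :
  inner x (a *: y + z) = a * inner x y + inner x z.
Proof. by rewrite /inner linearDl linearZl_LR. Qed.

Lemma inner_conj {H} (x y : H) : inner x y = (inner y x)^*.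
Proof. by rewrite /inner hermC /= expr0 mul1r. Qed.

Lemma innerDr {H} (x y z : H) : inner x (y + z) = inner x y + inner x z.
Proof. by rewrite /inner linearDl. Qed.

Lemma innerZr {H} (x y : H) (a : R[i]) : inner x (a *: y) = a * inner x y.
Proof. by rewrite /inner linearZl_LR. Qed.

Lemma inner0r {H} (x : H) : inner x 0 = 0.
Proof. by rewrite /inner linear0l. Qed.

Lemma innerNr {H} (x y : H) : inner x (- y) = - inner x y.
Proof. by rewrite /inner linearNl. Qed.

Lemma innerBr {H} (x y z : H) : inner x (y - z) = inner x y - inner x z.
Proof. by rewrite innerDr innerNr. Qed.

Lemma innerDl {H} (x y z : H) : inner (x + y) z = inner x z + inner y z.
Proof. by rewrite inner_conj innerDr rmorphD/= -!inner_conj. Qed.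

Lemma innerZl {H} (x y : H) (a : R[i]) : inner (a *: x) y = a^* * inner x y.
Proof. by rewrite inner_conj innerZr rmorphM/= -inner_conj. Qed.

Lemma inner0l {H} (x : H) : inner 0 x = 0.
Proof. by rewrite inner_conj inner0r conjc0. Qed.

Lemma innerNl {H} (x y : H) : inner (- x) y = - inner x y.
Proof. by rewrite inner_conj innerNr rmorphN/= -inner_conj. Qed.

Lemma innerBl {H} (x y z : H) : inner (x - y) z = inner x z - inner y z.
Proof. by rewrite innerDl innerNl. Qed.

Lemma inner_sumr {H} (I : Type) (s : seq I) (x : H) (F : I -> H) :
  inner x (\sum_(i <- s) F i) = \sum_(i <- s) inner x (F i).
Proof.
by elim/big_rec2: _ => [|i y z _ <-]; rewrite ?inner0r// innerDr.
Qed.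

Lemma inner_suml {H} (I : Type) (s : seq I) (x : H) (F : I -> H) :
  inner (\sum_(i <- s) F i) x = \sum_(i <- s) inner (F i) x.
Proof.
by elim/big_rec2: _ => [|i y z _ <-]; rewrite ?inner0l// innerDl.
Qed.

Lemma rdotC {H} (x y : H) : rdot x y = rdot y x.
Proof. by rewrite /rdot inner_conj; case: (inner y x). Qed.

Lemma rdotDr {H} (x y z : H) : rdot x (y + z) = rdot x y + rdot x z.
Proof. by rewrite /rdot innerDr raddfD. Qed.

Lemma rdotZr {H} (x y : H) (t : R) : rdot x (t%:C *: y) = t * rdot x y.
Proof. by rewrite /rdot innerZr; case: (inner x y) => p q /=; ring. Qed.

Lemma rdotDl {H} (x y z : H) : rdot (x + y) z = rdot x z + rdot y z.
Proof. by rewrite ![rdot _ z]rdotC rdotDr. Qed.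

Lemma rdotZl {H} (x y : H) (t : R) : rdot (t%:C *: x) y = t * rdot x y.
Proof. by rewrite ![rdot _ y]rdotC rdotZr. Qed.

Lemma rdotNr {H} (x y : H) : rdot x (- y) = - rdot x y.
Proof. by rewrite /rdot innerNr raddfN. Qed.

Lemma rdotNl {H} (x y : H) : rdot (- x) y = - rdot x y.
Proof. by rewrite ![rdot _ y]rdotC rdotNr. Qed.

Lemma rdotii {H} (x y : H) : rdot x ('i%C *: y) = - Im (inner x y).
Proof. by rewrite /rdot innerZr; case: (inner x y) => p q /=; ring. Qed.

Lemma innerxx {H} (x : H) : inner x x = (nrm x ^+ 2)%:C.
Proof. by rewrite /inner -normr_hdot normE -rmorphXn. Qed.

Lemma rdotxx {H} (x : H) : rdot x x = nrm x ^+ 2.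
Proof. by rewrite /rdot innerxx. Qed.

Lemma nrm_ge0 {H} (x : H) : 0 <= nrm x.
Proof. by have := normr_ge0 x; rewrite normE ler0c. Qed.

Lemma nrm0 {H} : nrm (0 : H) = 0.
Proof. by rewrite /nrm normr0. Qed.

Lemma nrm_eq0 {H} (x : H) : nrm x = 0 -> x = 0.
Proof. by move=> x0; apply/eqP; rewrite -normr_eq0 normE x0. Qed.

Lemma nrmD {H} (x y : H) : nrm (x + y) <= nrm x + nrm y.
Proof. by have := ler_normD x y; rewrite !normE -rmorphD lecR. Qed.

Lemma nrmN {H} (x : H) : nrm (- x) = nrm x.
Proof. by rewrite /nrm normrN. Qed.

Lemma nrmZ {H} (a : R[i]) (x : H) : nrm (a *: x) = Re `|a| * nrm x.
Proof.
rewrite /nrm normrZ !normE -{1}(@RRe_real _ `|a|) ?ger0_real//.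
by rewrite -rmorphM.
Qed.

Lemma Re_norm_ge0 (a : R[i]) : 0 <= Re `|a|.
Proof. by have := normr_ge0 a; rewrite lecE => /andP[]. Qed.

Lemma nrm_sqrB {H} (x y : H) :
  nrm (x - y) ^+ 2 = nrm x ^+ 2 - 2 * rdot x y + nrm y ^+ 2.
Proof.
rewrite -!rdotxx rdotDr !rdotDl !rdotNr !rdotNl (rdotC y x); ring.
Qed.

Lemma nrm_sqrDZ {H} (x y : H) (t : R) :
  nrm (x + t%:C *: y) ^+ 2 =
  nrm x ^+ 2 + 2 * t * rdot x y + t ^+ 2 * nrm y ^+ 2.
Proof.
rewrite -!rdotxx rdotDr !rdotDl !rdotZr !rdotZl (rdotC y x); ring.
Qed.

Lemma rdot_le {H} (x y : H) : rdot x y <= nrm x * nrm y.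
Proof.
have [/nrm_eq0 ->|x0] := eqVneq (nrm x) 0.
  by rewrite rdotC /rdot inner0r nrm0 mul0r.
have {}x0 : 0 < nrm x by rewrite lt_def x0 nrm_ge0.
have [/nrm_eq0 ->|y0] := eqVneq (nrm y) 0.
  by rewrite /rdot inner0r nrm0 mulr0.
have {}y0 : 0 < nrm y by rewrite lt_def y0 nrm_ge0.
(* Expanding [| |y| x - |x| y |^2 >= 0] gives [2 |x| |y| (|x| |y| - Re <x|y>) >= 0]. *)
have /= := sqr_ge0 (nrm ((nrm y)%:C *: x + (- nrm x)%:C *: y)).
rewrite nrm_sqrDZ nrmZ normc_def /= expr0n/= addr0 sqrtr_sqr.
rewrite ger0_norm ?nrm_ge0// rdotZl => h.
have : 0 <= (2 * nrm y * nrm x) * (nrm x * nrm y - rdot x y) by lra.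
by rewrite pmulr_rge0 ?subr_ge0// !mulr_gt0.
Qed.

Lemma rdot_ge {H} (x y : H) : - (nrm x * nrm y) <= rdot x y.
Proof. by rewrite -(nrmN x) lerNl -rdotNl rdot_le. Qed.

Lemma inner_ext {H} (u v : H) : (forall y, inner y u = inner y v) -> u = v.
Proof.
move=> h; apply/eqP; rewrite -subr_eq0; apply/eqP/nrm_eq0/eqP.
by rewrite -sqrf_eq0 -rdotxx /rdot innerBr h subrr.
Qed.

Lemma ball_nrm {H} (x y : H) (e : R) : ball x e%:C y <-> nrm (x - y) < e.
Proof. by rewrite -ball_normE /ball_/= normE ltcR. Qed.

(** Comparable elements of [R[i]] have equal imaginary parts, so the positive [e] in the definitions
    of closures are real. *)
Lemma pos_complex (e : R[i]) : 0 < e -> exists2 r : R, 0 < r & e = r%:C.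
Proof.
move=> e0; have := e0; rewrite ltcE /= => /andP[_ re0]; exists (Re e) => //.
by rewrite RRe_real// gtr0_real.
Qed.

Lemma closureP {H} (A : set H) (v : H) :
  closure A v <-> forall e : R, 0 < e -> exists2 w, A w & nrm (v - w) < e.
Proof.
split=> [cAv e e0|h B /nbhs_ballP[e /= /pos_complex[r r0 ->] vB]].
  have /cAv[w [Aw /ball_nrm]] : nbhs v (ball v e%:C).
    by apply: nbhsx_ballx; rewrite ltcR.
  by exists w.
by have [w Aw /ball_nrm vw] := h _ r0; exists w; split=> //; apply: vB.
Qed.

End RealNorm.


(** * Riesz representation for bounded linear relations *)

Section Riesz.
Context {R : realType}.
Implicit Types H K : hilbertType R.

(** The graph of a partial linear map, except that single-valuedness is left to follow from
    [bounded_rel]: [v = 0] forces [w = 0]. *)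
Definition linear_rel {H K} (G : H -> K -> Prop) : Prop :=
  G 0 0 /\ forall (a : R[i]) v w v' w',
    G v w -> G v' w' -> G (a *: v + v') (a *: w + w').

Definition bounded_rel {H K} (M : R) (G : H -> K -> Prop) : Prop :=
  forall v w, G v w -> nrm w <= M * nrm v.

Lemma nrm_lt_of_sqr (x e : R) : 0 <= x -> 0 < e -> x ^+ 2 < e ^+ 2 -> x < e.
Proof. by move=> x0 e0; rewrite ltr_pXn2r// nnegrE// ltW. Qed.

(** Near [t = 0] a linear term outgrows a quadratic one; the test value is [t = r / D] with [D > N].
    This is the first-order condition at a minimum, and the slack [e] allows for a minimum that is
    only approached. *)
Lemma quadratic_lin_eq0 (r N : R) :
  (forall t e : R, 0 < e -> t * r <= e + t ^+ 2 * N) -> r = 0.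
Proof.
move=> h.
have {}h t : t * r <= t ^+ 2 * N.
  by apply/ler_addgt0Pl => e e0; exact: h.
apply/eqP; rewrite -sqrf_eq0 eq_le sqr_ge0 andbT.
set D := `|N| + 1.
have D0 : 0 < D by rewrite ltr_wpDl// normr_ge0.
have ND : N <= D - 1 by rewrite /D addrK ler_norm.
have hr : r ^+ 2 * D <= r ^+ 2 * N.
  have := ler_wpM2r (sqr_ge0 D) (h (r / D)).
  have -> : r / D * r * D ^+ 2 = r ^+ 2 * D by field; rewrite gt_eqF.
  by have -> : (r / D) ^+ 2 * N * D ^+ 2 = r ^+ 2 * N by field; rewrite gt_eqF.
have := ler_wpM2l (sqr_ge0 r) ND; lra.
Qed.

(* The vector [u] is the limit of a minimizing sequence for
   [v |-> |v|^2 - 2 Re <y|w>] along [G v w]; such a sequence is Cauchy by the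
   parallelogram identity. *)
Lemma riesz_rel {H K} (G : H -> K -> Prop) (M : R) (y : K) :
  linear_rel G -> bounded_rel M G ->
  exists u, forall v w, G v w -> inner u v = inner y w.
Proof.
move=> [G0 Gl] GM.
have Gscale (a : R[i]) v w : G v w -> G (a *: v) (a *: w).
  by move=> Gvw; have := Gl a _ _ _ _ Gvw G0; rewrite !addr0.
pose phi (v : H) (w : K) : R := nrm v ^+ 2 - 2 * rdot y w.
pose S : set R := [set phi p.1 p.2 | p in [set p : H * K | G p.1 p.2]].
(* Completing the square: [|v|^2 - 2 |y| M |v| >= - (|y| M)^2]. *)
have lbS : lbound S (- (nrm y * M) ^+ 2).
  move=> _ [[v w] /= Gvw <-]; rewrite /phi.
  have h1 := rdot_le y w.
  have h2 := ler_wpM2l (nrm_ge0 y) (GM _ _ Gvw).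
  have := sqr_ge0 (nrm v - nrm y * M); lra.
have S0 : S !=set0 by exists (phi 0 0), (0, 0).
have hS : has_inf S by split=> //; exists (- (nrm y * M) ^+ 2).
pose m := inf S.
have mS v w : G v w -> m <= phi v w.
  by move=> Gvw; apply: ge_inf; [case: hS|exists (v, w)].
have appr e : 0 < e -> exists v w, G v w /\ phi v w < m + e.
  move=> e0; have [_ [[v w] /= Gvw <-] h] := inf_adherent e0 hS.
  by exists v, w.
(* The filter of sets containing all sufficiently good minimizers replaces a minimizing sequence. *)
pose F : set_system H := [set P | exists2 e : R, 0 < e &
  forall v w, G v w -> phi v w < m + e -> P v].
have FF : ProperFilter F.
  split; last split.
  - by move=> [e e0 h]; have [v [w [Gvw]]] := appr e e0; exact: h.
  - by exists 1.
  - move=> P Q [e e0 hP] [d d0 hQ]; exists (Num.min e d).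
      by rewrite lt_min e0.
    move=> v w Gvw h; split; [apply: (hP _ _ Gvw)|apply: (hQ _ _ Gvw)].
      by rewrite (lt_le_trans h)// lerD2l ge_min lexx.
    by rewrite (lt_le_trans h)// lerD2l ge_min lexx orbT.
  - by move=> P Q PQ [e e0 hP]; exists e => // v w Gvw h; apply/PQ/(hP v w).
(* The value of [phi] at the midpoint is the mean of the two values minus [|v - v'|^2 / 4], and it
   is at least [m]. *)
have midpoint v w v' w' e : 0 < e -> G v w -> G v' w' ->
    phi v w < m + e -> phi v' w' < m + e -> nrm (v - v') ^+ 2 <= 4 * e.
  move=> e0 Gvw Gvw' hv hv'.
  pose h : R[i] := (2^-1)%:C.
  have := mS _ _ (Gscale h _ _ (Gl 1 _ _ _ _ Gvw Gvw')).
  rewrite !scale1r /phi -rdotxx !rdotZr !rdotZl !rdotDr !rdotDl !rdotxx.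
  rewrite (rdotC v' v) nrm_sqrB => hm; move: hv hv'; rewrite /phi; lra.
have cF : cauchy F.
  apply: cauchy_exP => _ /pos_complex[e e0 ->].
  (* With this tolerance [midpoint] gives [|v - v'|^2 <= e^2 / 2]. *)
  have d0 : 0 < e ^+ 2 / 8 by rewrite divr_gt0// exprn_gt0.
  have [v [w [Gvw hv]]] := appr _ d0; exists v, (e ^+ 2 / 8) => //.
  move=> v' w' Gvw' hv'; apply/ball_nrm/nrm_lt_of_sqr => //.
    exact: nrm_ge0.
  have := midpoint _ _ _ _ _ d0 Gvw Gvw' hv hv'; lra.
have /cvg_ex[u Fu] := @cauchy_cvg _ F FF cF.
have near_u e : 0 < e ->
    exists p q, [/\ G p q, phi p q < m + e & nrm (u - p) < e].
  move=> e0.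
  have : F (ball u e%:C) by apply: Fu; apply: nbhsx_ballx; rewrite ltcR.
  move=> [d d0 hd].
  have md0 : 0 < Num.min d e by rewrite lt_min d0.
  have [p [q [Gpq h]]] := appr _ md0; exists p, q; split=> //.
    by rewrite (lt_le_trans h)// lerD2l ge_min lexx orbT.
  apply/ball_nrm/(hd p q) => //.
  by rewrite (lt_le_trans h)// lerD2l ge_min lexx.
have key v w : G v w -> rdot u v = rdot y w.
  move=> Gvw; apply/eqP; rewrite -subr_eq0; apply/eqP.
  suff h t e : 0 < e -> - (2 * t) * (rdot u v - rdot y w) <=
      e + t ^+ 2 * nrm v ^+ 2.
    apply: (@quadratic_lin_eq0 _ (nrm v ^+ 2 / 4)) => t e e0.
    by have := h (- t / 2) e e0; lra.
  (* Replacing the minimizer [u] by a pair [(p, q)] with tolerance [e / D] costs [e / D] in the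
     value of [phi] and [2 |t| |v| e / D] in the inner product, in total [e]. *)
  move=> e0; pose D := 1 + 2 * `|t| * nrm v.
  have D0 : 0 < D.
    rewrite ltr_pwDl// mulr_ge0 ?nrm_ge0//.
    by rewrite mulr_ge0.
  have eD : 0 < e / D by rewrite divr_gt0.
  have [p [q [Gpq pm pu]]] := near_u _ eD.
  have := mS _ _ (Gl t%:C _ _ _ _ Gvw Gpq).
  rewrite /phi (addrC _ p) nrm_sqrDZ rdotDr rdotZr => hm.
  have h1 : `|t * rdot (u - p) v| <= `|t| * (e / D * nrm v).
    rewrite normrM ler_wpM2l// ler_norml.
    have := rdot_le (u - p) v; have := rdot_ge (u - p) v.
    have := ler_wpM2r (nrm_ge0 v) (ltW pu).
    by move=> *; apply/andP; split; lra.
  have h2 := ler_norm (- (t * rdot (u - p) v)).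
  rewrite normrN in h2.
  have h3 : e / D * (1 + 2 * `|t| * nrm v) = e by rewrite -/D mulfVK// gt_eqF.
  move: h1 h2 pm; rewrite rdotDl rdotNl /phi; lra.
(* Real parts agree by [key]; applying [key] to [(i v, i w)] makes the imaginary parts agree. *)
exists u => v w Gvw; have h1 := key _ _ Gvw.
have := key _ _ (Gscale 'i%C _ _ Gvw); rewrite !rdotii => /oppr_inj h2.
move: h1 h2; rewrite /rdot.
by case: (inner u v) (inner y w) => p q [p' q'] /= -> ->.
Qed.

End Riesz.

(** * Adjoints and extension of bounded operators *)

Section BoundedOperators.
Context {R : realType}.
Implicit Types H K L : hilbertType R.

Lemma bounded_opP {H K} (T : H -> K) : bounded_op T <->
  linear T /\ exists2 M : R, 0 <= M & forall x, nrm (T x) <= M * nrm x.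
Proof.
split=> -[lT [M]]; last first.
  by move=> M0 hM; split=> //; exists M%:C => x; rewrite !normE -rmorphM lecR.
(* On the zero space the given [M] can be any complex number, hence the maximum with [0]. *)
move=> hM; split=> //; exists (Num.max (Re M) 0).
  by rewrite le_max lexx orbT.
move=> x; have := hM x; rewrite !normE lecE => /andP[_].
have -> : Re (M * (nrm x)%:C) = Re M * nrm x by case: (M) => p q /=; ring.
move=> /le_trans; apply; rewrite ler_wpM2r ?nrm_ge0// le_max lexx//.
Qed.

Section Linear.
Variables (H K : hilbertType R) (T : H -> K).
Hypothesis bT : bounded_op T.

Lemma opP (a : R[i]) x y : T (a *: x + y) = a *: T x + T y.
Proof. by case: bT => lT _; exact: lT. Qed.

Lemma op0 : T 0 = 0.
Proof.
have := opP 1 0 0; rewrite scaler0 addr0 scale1r => /eqP.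
by rewrite -subr_eq0 opprD addNKr oppr_eq0 => /eqP.
Qed.

Lemma opZ (a : R[i]) x : T (a *: x) = a *: T x.
Proof. by have := opP a x 0; rewrite op0 !addr0. Qed.

Lemma opD x y : T (x + y) = T x + T y.
Proof. by have := opP 1 x y; rewrite !scale1r. Qed.

Lemma opN x : T (- x) = - T x.
Proof. by rewrite -scaleN1r opZ scaleN1r. Qed.

Lemma opB x y : T (x - y) = T x - T y.
Proof. by rewrite opD opN. Qed.

End Linear.

Lemma bounded_op_comp {H K L} (S : K -> L) (T : H -> K) :
  bounded_op S -> bounded_op T -> bounded_op (S \o T).
Proof.
move=> bS bT; apply/bounded_opP; split=> [a x y|] /=; first by rewrite !opP.
have [_ [M M0 hM]] := (bounded_opP S).1 bS.
have [_ [N N0 hN]] := (bounded_opP T).1 bT.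
exists (M * N); first exact: mulr_ge0.
by move=> x /=; rewrite (le_trans (hM _))// -mulrA ler_wpM2l.
Qed.

Lemma bounded_op0 {H K} : bounded_op (0 : H -> K).
Proof.
apply/bounded_opP; split=> [a x y|]; first by rewrite /= scaler0 addr0.
by exists 0 => // x; rewrite nrm0 mul0r.
Qed.

Lemma fun_lcE {H K} (a : R[i]) (S T : H -> K) x :
  (a *: S + T) x = a *: S x + T x.
Proof. by []. Qed.

Lemma bounded_opLC {H K} (a : R[i]) (S T : H -> K) :
  bounded_op S -> bounded_op T -> bounded_op (a *: S + T).
Proof.
move=> bS bT; apply/bounded_opP; split=> [c x y|].
  rewrite !fun_lcE (opP bS) (opP bT) !scalerDr !scalerA (mulrC a c) -!addrA.
  by congr (_ + _); rewrite addrCA.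
have [_ [M M0 hM]] := (bounded_opP S).1 bS.
have [_ [N N0 hN]] := (bounded_opP T).1 bT.
exists (Re `|a| * M + N); first by rewrite addr_ge0// mulr_ge0 ?Re_norm_ge0.
move=> x; rewrite fun_lcE (le_trans (nrmD _ _))// mulrDl lerD//.
by rewrite nrmZ -mulrA ler_wpM2l ?Re_norm_ge0.
Qed.

Definition adjoint_pair {H K} (T : H -> K) (S : K -> H) : Prop :=
  forall x y, inner (T x) y = inner x (S y).

Definition dense_dom {H K} (G : H -> K -> Prop) : Prop :=
  forall v (e : R), 0 < e -> exists v' w', G v' w' /\ nrm (v - v') < e.

Lemma rdot_dense_ext {H K} (G : H -> K -> Prop) (u u' : H) : dense_dom G ->
  (forall v w, G v w -> inner u v = inner u' v) -> u = u'.
Proof.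
move=> dG h; apply/eqP; rewrite -subr_eq0; apply/eqP/nrm_eq0.
apply/eqP; rewrite eq_le nrm_ge0 andbT.
apply/ler_addgt0Pl => e e0; rewrite addr0.
have [v [w [Gvw huv]]] := dG (u - u') e e0.
have o : rdot (u - u') v = 0 by rewrite /rdot innerBl (h _ _ Gvw) subrr.
have [->|n0] := eqVneq (nrm (u - u')) 0; first exact: ltW.
have {}n0 : 0 < nrm (u - u') by rewrite lt_def n0 nrm_ge0.
rewrite -(ler_pM2l n0) -expr2 -rdotxx.
have -> : rdot (u - u') (u - u') = rdot (u - u') (u - u' - v).
  by rewrite [RHS]rdotDr rdotNr o subr0.
by rewrite (le_trans (rdot_le _ _))// ler_pM2l// ltW.
Qed.

Lemma adjoint_rel {H K} (G : H -> K -> Prop) (M : R) : 0 <= M ->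
  linear_rel G -> bounded_rel M G -> dense_dom G ->
  exists S : K -> H, [/\ bounded_op S, (forall y, nrm (S y) <= M * nrm y)
    & forall v w y, G v w -> inner w y = inner v (S y)].
Proof.
move=> M0 lG bG dG.
have [S hS] := choice (fun y => riesz_rel y lG bG).
have Slin : linear S.
  move=> a x y; apply: (rdot_dense_ext dG) => v w Gvw.
  by rewrite (hS _ _ _ Gvw) !innerDl !innerZl !(hS _ _ _ Gvw).
have SM y : nrm (S y) <= M * nrm y.
  apply/ler_addgt0Pl => e e0.
  (* [S y] may lie outside the domain of [G], so it is replaced by some [v] at distance below [d].
     The error in [|S y|^2 <= |S y| M |y|] is at most [d (|S y| + M |y|)], which [N] turns into
     [e |S y|]. *)
  pose N := 2 * nrm (S y) + 2 * M * nrm y + 1.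
  have N0 : 0 < N.
    rewrite ltr_wpDl// addr_ge0// !mulr_ge0 ?nrm_ge0//.
  have [S0|n0] := eqVneq (nrm (S y)) 0.
    by rewrite S0 addr_ge0 ?(ltW e0)// mulr_ge0 ?nrm_ge0.
  have {}n0 : 0 < nrm (S y) by rewrite lt_def n0 nrm_ge0.
  pose d := e * nrm (S y) / N.
  have d0 : 0 < d by rewrite divr_gt0// mulr_gt0.
  have [v [w [Gvw hv]]] := dG (S y) d d0.
  have h1 : rdot (S y) v = rdot y w by rewrite /rdot (hS _ _ _ Gvw).
  have h2 := rdot_le y w.
  have h3 := ler_wpM2l (nrm_ge0 y) (bG _ _ Gvw).
  have h4 := rdot_le (S y) (S y - v).
  have h5 := ler_wpM2l (nrm_ge0 (S y)) (ltW hv).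
  have h6 : nrm v <= nrm (S y) + d.
    rewrite -[v](subKr (S y)) (le_trans (nrmD _ _))// nrmN lerD2l// ltW//.
  have h7 : nrm y * (M * nrm v) <= nrm y * (M * (nrm (S y) + d)).
    by rewrite !ler_wpM2l ?nrm_ge0.
  rewrite -(ler_pM2l n0) -expr2 -rdotxx.
  have h8 : rdot (S y) (S y - v) = rdot (S y) (S y) - rdot (S y) v.
    by rewrite rdotDr rdotNr.
  have h9 : d * N = e * nrm (S y) by rewrite /d mulfVK// gt_eqF.
  have h10 : d * (nrm (S y) + M * nrm y) <= d * N.
    rewrite ler_pM2l// /N.
    have := mulr_ge0 M0 (nrm_ge0 y); lra.
  lra.
exists S; split=> //.
- by apply/bounded_opP; split=> //; exists M.
- by move=> v w y Gvw; rewrite inner_conj -(hS _ _ _ Gvw) -inner_conj.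
Qed.

Definition graph {H K} (T : H -> K) : H -> K -> Prop := fun v w => w = T v.

Lemma graph_dense {H K} (T : H -> K) : dense_dom (graph T).
Proof. by move=> v e e0; exists v, (T v); split=> //; rewrite subrr nrm0. Qed.

Lemma graph_linear {H K} (T : H -> K) : bounded_op T -> linear_rel (graph T).
Proof.
move=> bT; split; first by rewrite /graph op0.
by move=> a v w v' w' -> ->; rewrite /graph (opP bT).
Qed.

(** The Riesz operator of the graph of [T] is a candidate, so [adjoint] does not fall back on the
    default [0]. *)
Lemma adjoint_spec {H K} (T : H -> K) : bounded_op T ->
  bounded_op (adjoint T) /\ adjoint_pair T (adjoint T).
Proof.
move=> bT; have [_ [M M0 hM]] := (bounded_opP T).1 bT.
have bG : bounded_rel M (graph T) by move=> v w ->.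
have [S [bS _ hS]] := adjoint_rel M0 (graph_linear bT) bG (@graph_dense _ _ T).
rewrite /adjoint; case: xgetP => [S' _ //|/(_ S) []].
by split=> // x y; exact: hS.
Qed.

Lemma adjoint_bounded {H K} (T : H -> K) :
  bounded_op T -> bounded_op (adjoint T).
Proof. by move=> /adjoint_spec[]. Qed.

Lemma inner_adjoint {H K} (T : H -> K) x y : bounded_op T ->
  inner (T x) y = inner x (adjoint T y).
Proof. by move=> /adjoint_spec[]. Qed.

Lemma inner_adjointl {H K} (T : H -> K) x y : bounded_op T ->
  inner (adjoint T x) y = inner x (T y).
Proof. by move=> bT; rewrite inner_conj -inner_adjoint// -inner_conj. Qed.

Lemma adjoint_unique {H K} (T : H -> K) (S : K -> H) : bounded_op T ->
  adjoint_pair T S -> adjoint T = S.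
Proof.
move=> bT h; apply/funext => y; apply: inner_ext => x.
by rewrite -inner_adjoint// h.
Qed.

Lemma adjointK {H K} (T : H -> K) : bounded_op T -> adjoint (adjoint T) = T.
Proof.
move=> bT; apply: adjoint_unique; first exact: adjoint_bounded.
by move=> x y; rewrite inner_adjointl.
Qed.

Lemma adjoint_comp {H K L} (S : K -> L) (T : H -> K) :
  bounded_op S -> bounded_op T -> adjoint (S \o T) = adjoint T \o adjoint S.
Proof.
move=> bS bT; apply: adjoint_unique; first exact: bounded_op_comp.
by move=> x y; rewrite /= !inner_adjoint.
Qed.

Lemma adjointLC {H K} (a : R[i]) (S T : H -> K) :
  bounded_op S -> bounded_op T ->
  adjoint (a *: S + T) = a^* *: adjoint S + adjoint T.
Proof.
move=> bS bT; apply: adjoint_unique; first exact: bounded_opLC.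
move=> x y; rewrite !fun_lcE innerDl innerZl innerDr innerZr.
by rewrite !inner_adjoint.
Qed.

Lemma adjoint_le {H K} (T : H -> K) (M : R) : bounded_op T -> 0 <= M ->
  (forall x, nrm (T x) <= M * nrm x) ->
  forall y, nrm (adjoint T y) <= M * nrm y.
Proof.
move=> bT M0 hM.
have bG : bounded_rel M (graph T) by move=> v w ->.
have [S [bS SM hS]] := adjoint_rel M0 (graph_linear bT) bG (@graph_dense _ _ T).
rewrite (@adjoint_unique _ _ T S)// => x y; exact: hS.
Qed.

(* The extension is the adjoint of the adjoint of the relation. *)
Lemma extend_rel {H K} (G : H -> K -> Prop) (M : R) : 0 <= M ->
  linear_rel G -> bounded_rel M G -> dense_dom G ->
  exists T : H -> K, [/\ bounded_op T, (forall x, nrm (T x) <= M * nrm x)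
    & forall v w, G v w -> T v = w].
Proof.
move=> M0 lG bG dG; have [S [bS SM hS]] := adjoint_rel M0 lG bG dG.
exists (adjoint S); split; [exact: adjoint_bounded|exact: adjoint_le|].
move=> v w Gvw; apply: inner_ext => y.
by rewrite -inner_adjoint// inner_conj -(hS _ _ _ Gvw) -inner_conj.
Qed.

End BoundedOperators.


(** * Closed spans of operators *)

Section ClosedSpans.
Context {R : realType}.
Implicit Types H K L : hilbertType R.

Lemma lin_span_min {V : lmodType R[i]} (Y W : set V) : W 0 ->
  (forall (a : R[i]) v w, W v -> W w -> W (a *: v + w)) ->
  Y `<=` W -> lin_span Y `<=` W.
Proof.
move=> W0 Wl YW _ [n [a [y [hy ->]]]].
elim/big_rec: _ => // i x _ Wx; exact/Wl/Wx/YW/hy.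
Qed.

Lemma lin_span0 {V : lmodType R[i]} (Y : set V) : lin_span Y 0.
Proof.
by exists 0%N, (fun=> 0), (fun=> 0); rewrite big_ord0; split=> // -[].
Qed.

Lemma lin_spanLC {V : lmodType R[i]} (Y : set V) (b : R[i]) v w :
  lin_span Y v -> lin_span Y w -> lin_span Y (b *: v + w).
Proof.
move=> [n [a [y [hy ->]]]] [m [c [z [hz ->]]]].
exists (n + m)%N.
exists (fun i =>
  match fintype.split i with inl j => b * a j | inr j => c j end).
exists (fun i => match fintype.split i with inl j => y j | inr j => z j end).
split=> [i|]; first by case: (fintype.split i).
rewrite big_split_ord scaler_sumr; congr (_ + _); apply: eq_bigr => i _.
  by rewrite (unsplitK (inl i)) scalerA.
by rewrite (unsplitK (inr i)).
Qed.

Lemma sub_lin_span {V : lmodType R[i]} (Y : set V) : Y `<=` lin_span Y.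
Proof.
move=> y Yy; exists 1%N, (fun=> 1), (fun=> y).
by rewrite big_ord1 scale1r.
Qed.

Definition closed_subspace {H} (W : set H) : Prop :=
  [/\ W 0, (forall (a : R[i]) v w, W v -> W w -> W (a *: v + w))
    & closure W `<=` W].

Lemma closed_span_min {H} (Y W : set H) :
  closed_subspace W -> Y `<=` W -> closed_span Y `<=` W.
Proof.
move=> [W0 Wl cW] YW v /closureP hv; apply/cW/closureP => e /hv[w Yw vw].
by exists w => //; move: w Yw {vw}; exact: lin_span_min.
Qed.

Lemma sub_closed_span {H} (Y : set H) : Y `<=` closed_span Y.
Proof. by move=> y Yy; apply: subset_closure; exact: sub_lin_span. Qed.

Lemma closed_span_subspace {H} (Y : set H) : closed_subspace (closed_span Y).
Proof.
split; first exact/subset_closure/lin_span0.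
- move=> a v w /closureP hv /closureP hw; apply/closureP => e e0.
  have d0 : 0 < e / 2 by rewrite divr_gt0.
  have N0 : 0 < Re `|a| + 1 by rewrite ltr_wpDl// Re_norm_ge0.
  have [v' Yv' vv'] := hv (e / 2 / (Re `|a| + 1)) (divr_gt0 d0 N0).
  have [w' Yw' ww'] := hw _ d0.
  exists (a *: v' + w'); first exact: lin_spanLC.
  rewrite opprD addrACA -scalerBr (le_lt_trans (nrmD _ _))// nrmZ.
  rewrite [ltRHS]splitr ler_ltD//.
  move: vv'; rewrite ltr_pdivlMr// => /ltW; apply: le_trans.
  by rewrite mulrDr mulr1 mulrC lerDl nrm_ge0.
- exact: closed_closure.
Qed.

Lemma preimage_closed_subspace {H K} (T : H -> K) (W : set K) :
  bounded_op T -> closed_subspace W -> closed_subspace (T @^-1` W).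
Proof.
move=> bT [W0 Wl cW]; split=> /=; first by rewrite op0.
  by move=> a v w Wv Ww /=; rewrite (opP bT); exact: Wl.
move=> v /closureP hv; apply/cW/closureP => e e0.
have [_ [M M0 hM]] := (bounded_opP T).1 bT.
have N0 : 0 < M + 1 by rewrite ltr_wpDl.
have [w Ww vw] := hv _ (divr_gt0 e0 N0).
exists (T w) => //; rewrite -(opB bT) (le_lt_trans (hM _))//.
move: vw; rewrite ltr_pdivlMr//; apply: le_lt_trans.
by rewrite mulrDr mulr1 mulrC lerDl nrm_ge0.
Qed.

Lemma kernel_closed_subspace {H K} (T : H -> K) :
  bounded_op T -> closed_subspace (T @^-1` [set 0]).
Proof.
move=> bT; apply: preimage_closed_subspace => //; split=> //.
  by move=> a v w -> ->; rewrite scaler0 addr0.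
move=> v /closureP hv; apply: nrm_eq0; apply/eqP.
rewrite eq_le nrm_ge0 andbT; apply/ler_addgt0Pl => e /hv[_ -> ].
by rewrite subr0 addr0 => /ltW.
Qed.

Lemma op_ext {H K} (Y : set H) (S T : H -> K) : closed_span Y = setT ->
  bounded_op S -> bounded_op T -> (forall y, Y y -> S y = T y) -> S = T.
Proof.
move=> dY bS bT h; apply/funext => v.
have bD := bounded_opLC (-1) bS bT.
have YD : Y `<=` (-1 *: S + T) @^-1` [set 0].
  by move=> y Yy /=; rewrite fun_lcE h// scaleN1r addNr.
have : closed_span Y v by rewrite dY.
move=> /(closed_span_min (kernel_closed_subspace bD) YD) /=.
by rewrite fun_lcE scaleN1r addrC => /eqP; rewrite subr_eq0 => /eqP.
Qed.

Lemma op_closureP {H K} (Y : set (H -> K)) (T : H -> K) :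
  op_closure Y T <-> bounded_op T /\ forall e : R, 0 < e ->
    exists2 S, Y S & forall x, nrm (T x - S x) <= e * nrm x.
Proof.
split=> -[bT h]; split=> // e.
  move=> e0; have [|S YS hS] := h e%:C; first by rewrite ltcR.
  by exists S => // x; have := hS x; rewrite !normE -rmorphM lecR.
move=> /pos_complex[r r0 ->]; have [S YS hS] := h r r0.
by exists S => // x; rewrite !normE -rmorphM lecR.
Qed.

Lemma op_closed_span_min {H K} (Y V : set (H -> K)) :
  op_closed_subspace V -> Y `<=` V -> op_closed_span Y `<=` V.
Proof.
move=> [_ V0 Vl cV] YV T [bT hT]; apply: cV; split=> // e /hT[S YS TS].
by exists S => //; move: S YS {TS}; exact: lin_span_min.
Qed.

Lemma sub_op_closed_span {H K} (Y : set (H -> K)) :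
  Y `<=` bounded_op -> Y `<=` op_closed_span Y.
Proof.
move=> bY y Yy; apply/op_closureP; split; first exact: bY.
move=> e e0; exists y; first exact: sub_lin_span.
by move=> x; rewrite subrr nrm0 mulr_ge0 ?nrm_ge0// ltW.
Qed.

Lemma op_closed_span_subspace {H K} (Y : set (H -> K)) :
  op_closed_subspace (op_closed_span Y).
Proof.
split; first by move=> T [].
- apply/op_closureP; split; first exact: bounded_op0.
  move=> e e0; exists 0; first exact: lin_span0.
  by move=> x; rewrite subrr nrm0 mulr_ge0 ?nrm_ge0// ltW.
- move=> a S T /op_closureP[bS hS] /op_closureP[bT hT].
  apply/op_closureP; split; first exact: bounded_opLC.
  move=> e e0; have d0 : 0 < e / 2 by rewrite divr_gt0.
  have N0 : 0 < Re `|a| + 1 by rewrite ltr_wpDl// Re_norm_ge0.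
  have [S' YS' SS'] := hS (e / 2 / (Re `|a| + 1)) (divr_gt0 d0 N0).
  have [T' YT' TT'] := hT _ d0.
  exists (a *: S' + T'); first exact: lin_spanLC.
  move=> x; rewrite !fun_lcE opprD addrACA -scalerBr.
  rewrite (le_trans (nrmD _ _))// nrmZ (splitr e) mulrDl lerD//.
  rewrite (le_trans (ler_wpM2l (Re_norm_ge0 _) (SS' x)))//.
  rewrite mulrA ler_wpM2r ?nrm_ge0// mulrCA ler_piMr ?(ltW d0)//.
  by rewrite ler_pdivrMr// mul1r lerDl.
- move=> T /op_closureP[bT hT]; apply/op_closureP; split=> // e e0.
  have d0 : 0 < e / 2 by rewrite divr_gt0.
  have [S /op_closureP[bS hS] TS] := hT _ d0.
  have [S' YS' SS'] := hS _ d0; exists S' => // x.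
  rewrite -(subrKA (S x)) (le_trans (nrmD _ _))// (splitr e) mulrDl.
  exact: lerD.
Qed.

Lemma bounded_op_closed_subspace {H K} :
  op_closed_subspace (@bounded_op R H K).
Proof.
split=> //; first exact: bounded_op0.
- by move=> a S T; exact: bounded_opLC.
- by move=> T [].
Qed.

(** The conjunct [bounded_op T] keeps the intersection a space of bounded operators even when the
    index set is empty. *)
Lemma op_closed_subspace_bigcap {H K} (I : Type) (P : set I)
    (W : I -> set (H -> K)) : (forall i, P i -> op_closed_subspace (W i)) ->
  op_closed_subspace [set T | bounded_op T /\ forall i, P i -> W i T].
Proof.
move=> cW; split=> [T []//|||].
- by split=> [|i /cW[]//]; exact: bounded_op0.
- move=> a S T [bS WS] [bT WT]; split; first exact: bounded_opLC.
  by move=> i Pi; have [_ _ + _] := cW _ Pi; apply; [exact: WS|exact: WT].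
- move=> T [bT hT]; split=> // i Pi; have [_ _ _] := cW _ Pi; apply.
  by split=> // e /hT[S [_ WS] TS]; exists S => //; exact: WS.
Qed.

Lemma op_closed_subspaceI {H K} (U V : set (H -> K)) :
  op_closed_subspace U -> op_closed_subspace V -> op_closed_subspace (U `&` V).
Proof.
move=> [bU U0 Ul cU] [_ V0 Vl cV]; split=> [T [] /bU//|//||].
- by move=> a S T [? ?] [? ?]; split; [exact: Ul|exact: Vl].
- move=> T [bT hT]; split; [apply: cU|apply: cV]; split=> // e.
    by move=> /hT[S []]; exists S.
  by move=> /hT[S []]; exists S.
Qed.

(* [theta] is either the identity or the complex conjugation. *)
Lemma op_preimage_subspace {H K H' K'}
    (U : set (H -> K)) (V : set (H' -> K')) (theta : R[i] -> R[i])
    (Phi : (H -> K) -> (H' -> K')) (M : R) :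
  op_closed_subspace U -> op_closed_subspace V -> 0 <= M ->
  theta (-1) = -1 ->
  (forall a S T, U S -> U T -> Phi (a *: S + T) = theta a *: Phi S + Phi T) ->
  (forall T, U T -> bounded_op (Phi T)) ->
  (forall T e, U T -> 0 <= e -> (forall x, nrm (T x) <= e * nrm x) ->
    forall x, nrm (Phi T x) <= M * e * nrm x) ->
  op_closed_subspace [set T | U T /\ V (Phi T)].
Proof.
move=> [bU U0 Ul cU] [bV V0 Vl cV] M0 theta1 lPhi bPhi cPhi.
(* The norm estimate on [Phi] is applied to [T - S], written as [-1 *: S + T]; this is where
   [theta (-1) = -1] enters. *)
have diff S T : U S -> U T -> Phi (-1 *: S + T) = - Phi S + Phi T.
  by move=> US UT; rewrite lPhi// theta1 scaleN1r.
split=> [T []|||]; first by move=> /bU.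
- split=> //; have := diff _ _ U0 U0.
  by rewrite scaler0 addr0 addNr => ->.
- by move=> a S T [US VS] [UT VT]; split; [exact: Ul|rewrite lPhi//; exact: Vl].
- move=> T /op_closureP[bT hT].
  have UT : U T.
    by apply/cU/op_closureP; split=> // e /hT[S [US _] ST]; exists S.
  split=> //; apply/cV/op_closureP; split; first exact: bPhi.
  move=> e e0; have N0 : 0 < M + 1 by rewrite ltr_wpDl.
  have d0 := divr_gt0 e0 N0.
  have [S [US VS] TS] := hT _ d0; exists (Phi S) => // x.
  have : nrm ((- Phi S + Phi T) x) <= M * (e / (M + 1)) * nrm x.
    rewrite -diff//; apply: cPhi; [exact: Ul|exact: ltW|].
    by move=> y; rewrite fun_lcE scaleN1r addrC.
  have -> : (- Phi S + Phi T) x = Phi T x - Phi S x by rewrite addrC.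
  move=> /le_trans; apply; rewrite ler_wpM2r ?nrm_ge0//.
  by rewrite mulrCA ler_piMr ?(ltW e0)// ler_pdivrMr// mul1r lerDl.
Qed.

Lemma comp_preimage_subspace {H K H' K'} (P : K -> K') (Q : H' -> H)
    (V : set (H' -> K')) : bounded_op P -> bounded_op Q ->
  op_closed_subspace V ->
  op_closed_subspace [set T | bounded_op T /\ V (P \o T \o Q)].
Proof.
move=> bP bQ cV.
have [_ [M M0 hM]] := (bounded_opP P).1 bP.
have [_ [N N0 hN]] := (bounded_opP Q).1 bQ.
apply: (@op_preimage_subspace _ _ _ _ _ V id (fun T => P \o T \o Q) (M * N))
  => //; first exact: bounded_op_closed_subspace.
- exact: mulr_ge0.
- by move=> a S T bS bT; apply/funext => x /=; rewrite !fun_lcE (opP bP).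
- by move=> T bT; do 2 apply: bounded_op_comp => //.
- move=> T e bT e0 hT x /=; rewrite (le_trans (hM _))// -!mulrA ler_wpM2l//.
  rewrite (le_trans (hT _))// mulrCA ler_wpM2l//.
Qed.

Lemma compl_preimage_subspace {H K K'} (P : K -> K')
    (V : set (H -> K')) : bounded_op P -> op_closed_subspace V ->
  op_closed_subspace [set T | bounded_op T /\ V (P \o T)].
Proof.
move=> bP cV; apply: (@comp_preimage_subspace _ _ _ _ P id) => //.
by apply/bounded_opP; split=> //; exists 1 => // x; rewrite mul1r.
Qed.

Lemma compr_preimage_subspace {H K H'} (Q : H' -> H)
    (V : set (H' -> K)) : bounded_op Q -> op_closed_subspace V ->
  op_closed_subspace [set T | bounded_op T /\ V (T \o Q)].
Proof.
move=> bQ cV; apply: (@comp_preimage_subspace _ _ _ _ id Q) => //.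
by apply/bounded_opP; split=> //; exists 1 => // x; rewrite mul1r.
Qed.

Lemma adjoint_preimage_subspace {H K} (V : set (K -> H)) :
  op_closed_subspace V ->
  op_closed_subspace [set T : H -> K | bounded_op T /\ V (adjoint T)].
Proof.
move=> cV.
apply: (@op_preimage_subspace _ _ _ _ _ V (fun a => a^*) adjoint 1) => //.
- exact: bounded_op_closed_subspace.
- by rewrite rmorphN rmorph1.
- by move=> a S T bS bT; exact: adjointLC.
- by move=> T; exact: adjoint_bounded.
- by move=> T e bT e0 hT x; rewrite mul1r; exact: adjoint_le.
Qed.

(** The form in which products with a closed span are tested on generators; [op_closed_span_compr]
    is its mirror image. *)
Lemma op_closed_span_compl {H K K'} (P : K -> K') (Y : set (H -> K))
    (V : set (H -> K')) : bounded_op P -> op_closed_subspace V ->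
  (forall T, Y T -> bounded_op T /\ V (P \o T)) ->
  forall T, op_closed_span Y T -> V (P \o T).
Proof.
move=> bP cV YV T YT.
by have [] := op_closed_span_min (compl_preimage_subspace bP cV) YV YT.
Qed.

Lemma op_closed_span_compr {H K H'} (Q : H' -> H) (Y : set (H -> K))
    (V : set (H' -> K)) : bounded_op Q -> op_closed_subspace V ->
  (forall T, Y T -> bounded_op T /\ V (T \o Q)) ->
  forall T, op_closed_span Y T -> V (T \o Q).
Proof.
move=> bQ cV YV T YT.
by have [] := op_closed_span_min (compr_preimage_subspace bQ cV) YV YT.
Qed.

Lemma op_mul_bounded {H K L} (X : set (K -> L)) (Y : set (H -> K)) :
  X `<=` bounded_op -> Y `<=` bounded_op -> op_mul X Y `<=` bounded_op.
Proof. by move=> bX bY _ [S /bX bS [T /bY bT <-]]; exact: bounded_op_comp. Qed.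

Lemma op_closed_span_mul {H K L} (X : set (K -> L)) (Y : set (H -> K)) S T :
  X `<=` bounded_op -> Y `<=` bounded_op -> X S -> Y T ->
  op_closed_span (op_mul X Y) (S \o T).
Proof.
move=> bX bY XS YT; apply: sub_op_closed_span; first exact: op_mul_bounded.
by exists S => //; exists T.
Qed.

End ClosedSpans.


(** * C*-modules over a C*-base *)

(** By log-convexity the ratios [a k.+1 / a k] do not decrease. If the first ratio [r] exceeded [M],
    then [a k >= r^k a 0] would outgrow [C M^k]. *)
Lemma log_convex_le (R : realType) (a : nat -> R) (C M : R) :
  (forall k, 0 <= a k) -> (forall k, a k.+1 ^+ 2 <= a k * a k.+2) ->
  0 <= M -> (forall k, a k <= C * M ^+ k) -> a 1%N <= M * a 0%N.
Proof.
move=> a0 aS M0 aC; rewrite leNgt; apply/negP => Ma.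
(* If [a 0] vanished, log-convexity at [k = 0] would make [a 1] vanish too, against
   [M a 0 < a 1]. *)
have a00 : 0 < a 0%N.
  rewrite lt_def a0 andbT; apply/negP => /eqP e; have := aS 0%N.
  rewrite e mul0r leNgt exprn_gt0//.
  by rewrite e mulr0 in Ma.
pose r := a 1%N / a 0%N.
have rM : M < r by rewrite ltr_pdivlMr.
have r0 : 0 < r by exact: le_lt_trans rM.
have ar k : 0 < a k /\ r * a k <= a k.+1.
  elim: k => [|k [ak rk]]; first by rewrite mulfVK// gt_eqF.
  have aSk : 0 < a k.+1 by rewrite (lt_le_trans _ rk)// mulr_gt0.
  split=> //; rewrite -(ler_pM2l ak); apply: le_trans (aS k).
  by rewrite expr2 mulrCA mulrA ler_pM2r.
have rka k : r ^+ k * a 0%N <= a k.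
  elim: k => [|k ih]; first by rewrite mul1r.
  by rewrite exprS -mulrA (le_trans _ (ar k).2)// ler_pM2l.
(* The ratio [r / M] needs [M] nonzero; for [M = 0] the growth bound at [k = 1] already contradicts
   [r a 0 > 0]. *)
have [M_eq0|Mn0] := eqVneq M 0.
  have := le_trans (rka 1%N) (aC 1%N); rewrite M_eq0 mulr0 leNgt.
  by rewrite mulr_gt0.
have {}M0 : 0 < M by rewrite lt_def Mn0.
have d0 : 0 < r / M - 1 by rewrite subr_gt0 ltr_pdivlMr// mul1r.
(* Bernoulli's inequality: the powers of [r / M > 1] are unbounded. *)
have bern k : 1 + k%:R * (r / M - 1) <= (r / M) ^+ k.
  elim: k => [|k ih]; first by rewrite mul0r addr0.
  rewrite exprS -natr1.
  have := ler_wpM2l (ltW (divr_gt0 r0 M0)) ih.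
  have := mulr_ge0 (ler0n R k) (sqr_ge0 (r / M - 1)); lra.
have bd k : (r / M) ^+ k <= C / a 0%N.
  rewrite expr_div_n ler_pdivrMr ?exprn_gt0// mulrAC ler_pdivlMr//.
  exact: le_trans (rka k) (aC k).
have := archi_boundP (normr_ge0 (C / a 0%N / (r / M - 1))).
set n := Num.bound _ => hn.
have := le_trans (bern n) (bd n).
move: hn => /(le_lt_trans (ler_norm _)); rewrite ltr_pdivrMr//; lra.
Qed.

Section Module.
Context {R : realType} {b : cbase R} {H : hilbertType R}.
Variable beta : set (cb_space b -> H).
Hypothesis hb : cmodule b beta.
Local Notation K0 := (cb_space b).

Lemma module_subspace : op_closed_subspace beta.
Proof. by case: hb. Qed.

Lemma module_bounded xi : beta xi -> bounded_op xi.
Proof. by case: module_subspace => + _ _ _; apply. Qed.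

Lemma module_mulr xi x : beta xi -> cb_alg b x -> beta (xi \o x).
Proof.
have [[[bB _ _ _] _ _] _] := cb_algP b.
move=> bxi bx; case: hb => _ _ <- _; apply: op_closed_span_mul => //.
exact: module_bounded.
Qed.

Lemma module_inner xi xi' : beta xi -> beta xi' -> cb_alg b (adjoint xi \o xi').
Proof.
move=> bxi bxi'; case: hb => _ _ _ <-; apply: op_closed_span_mul => //.
- by move=> _ [S /module_bounded/adjoint_bounded bS <-].
- exact: module_bounded.
- by exists xi.
Qed.

Lemma cb_dag_bounded x : cb_dag b x -> bounded_op x.
Proof. by have [[[+ _ _ _] _ _] _] := cb_dagP b; apply. Qed.

Lemma cb_dag_adjoint x : cb_dag b x -> cb_dag b (adjoint x).
Proof. by have [[_ _ +] _] := cb_dagP b => + bx; apply; exists x. Qed.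

Lemma inner_module xi xi' z z' : beta xi -> beta xi' ->
  inner (xi z) (xi' z') = inner z ((adjoint xi \o xi') z').
Proof. by move=> /module_bounded bxi _; rewrite inner_adjoint. Qed.

(** [x] lies in [cb_dag b] and [adjoint xi \o xi'] in [cb_alg b], so they commute: on vectors
    [xi z], the operator [x] crosses the inner product as its adjoint before any [rho b beta x] is
    available. *)
Lemma inner_module_shift x xi xi' z z' : cb_dag b x -> beta xi -> beta xi' ->
  inner (xi (x z)) (xi' z') = inner (xi z) (xi' (adjoint x z')).
Proof.
move=> dx bxi bxi'; have dx' := cb_dag_adjoint dx.
rewrite !inner_module// inner_adjoint; last exact: cb_dag_bounded.
congr inner; have /(_ _ _ (module_inner bxi bxi') dx') := @cb_comm _ b.
by move=> /(congr1 (fun f => f z')) /= ->.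
Qed.

(** A formal combination of generators is kept as a list, so that one list can be evaluated under
    several [Phi] and the results compared without knowing that the value depends only on the
    vector. *)
Definition comb {H' : hilbertType R} (Phi : (K0 -> H) -> K0 -> H')
    (s : seq (R[i] * ({xi | beta xi} * K0))) : H' :=
  \sum_(p <- s) p.1 *: Phi (sval p.2.1) p.2.2.

Lemma inner_comb {H' H'' : hilbertType R} (Phi Psi : (K0 -> H) -> K0 -> H')
    (Phi' Psi' : (K0 -> H) -> K0 -> H'') s s' :
  (forall xi xi' z z', beta xi -> beta xi' ->
    inner (Phi xi z) (Psi xi' z') = inner (Phi' xi z) (Psi' xi' z')) ->
  inner (comb Phi s) (comb Psi s') = inner (comb Phi' s) (comb Psi' s').
Proof.
move=> h; rewrite !inner_suml; apply: eq_bigr => p _.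
rewrite !inner_sumr; apply: eq_bigr => q _.
by rewrite !innerZl !innerZr h//; exact: svalP.
Qed.

Local Notation act x := (fun (xi : K0 -> H) z => xi (x z)).

Lemma rho_ineq x M s : cb_dag b x -> 0 <= M ->
  (forall z, nrm (x z) <= M * nrm z) ->
  nrm (comb (act x) s) <= M * nrm (comb (act id) s).
Proof.
move=> dx M0 hM; have bx := cb_dag_bounded dx; have dx' := cb_dag_adjoint dx.
pose h z := adjoint x (x z).
pose a k := nrm (comb (act (iter k h)) s).
(* One factor [h] crosses from the left argument to the right one; Cauchy-Schwarz does the rest. *)
have ha k : a k.+1 ^+ 2 <= a k * a k.+2.
  rewrite -rdotxx /rdot [inner _ _](_ : _ =
    inner (comb (act (iter k h)) s) (comb (act (iter k.+2 h)) s)).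
    exact: rdot_le.
  apply: inner_comb => xi xi' z z' bxi bxi' /=.
  rewrite {1}/h (inner_module_shift _ _ dx')// adjointK//.
  by rewrite (inner_module_shift _ _ dx).
have hz z : nrm (h z) <= M ^+ 2 * nrm z.
  rewrite /h (le_trans (adjoint_le bx M0 hM _))// expr2 -mulrA.
  by rewrite ler_wpM2l.
(* A crude triangle inequality over the list: [C] depends on [s], but only the growth rate [M^2] of
   the bound matters. *)
have [C hC] : exists C : R, forall k, a k <= C * (M ^+ 2) ^+ k.
  rewrite /a; elim: s {ha a} => [|p s [C ih]].
    by exists 0 => k; rewrite /comb big_nil nrm0 mul0r.
  have [_ [N N0 hN]] := (bounded_opP _).1 (module_bounded (svalP p.2.1)).
  exists (Re `|p.1| * (N * nrm p.2.2) + C) => k.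
  rewrite /comb big_cons (le_trans (nrmD _ _))// mulrDl lerD//; last exact: ih.
  rewrite nrmZ -mulrA ler_wpM2l ?Re_norm_ge0// (le_trans (hN _))//.
  rewrite -mulrA ler_wpM2l// mulrC.
  elim: k => [|k ihk]; first by rewrite mul1r.
  rewrite iterS (le_trans (hz _))// (exprS (M ^+ 2)).
  rewrite -(mulrA (M ^+ 2) ((M ^+ 2) ^+ k)).
  by rewrite ler_wpM2l ?sqr_ge0.
have a01 : a 1%N <= M ^+ 2 * a 0%N.
  by apply: (log_convex_le _ ha _ hC) => // *; rewrite ?nrm_ge0 ?sqr_ge0.
(* After squaring, the left side is the inner product of [sum xi z] with [sum xi (h z)], hence at
   most [a 0 * a 1]. *)
rewrite -(@ler_pXn2r _ 2)// ?nnegrE ?mulr_ge0 ?nrm_ge0//.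
rewrite -rdotxx /rdot [inner _ _](_ : _ =
  inner (comb (act id) s) (comb (act h) s)); last first.
  apply: inner_comb => xi xi' z z' bxi bxi' /=.
  by rewrite (inner_module_shift _ _ dx).
apply: (le_trans (rdot_le _ _)).
rewrite -/(a 1%N) -/(a 0%N) (le_trans (ler_wpM2l (nrm_ge0 _) a01))//.
by rewrite le_eqVlt; apply/orP; left; apply/eqP; rewrite /a/=; ring.
Qed.

(** The pairs of values of one list, under evaluation and under [Phi], form a relation that is
    bounded by assumption and densely defined because [[beta K] = H]. *)
Lemma extend_module {H' : hilbertType R} (Phi : (K0 -> H) -> K0 -> H') (M : R) :
  0 <= M -> (forall s, nrm (comb Phi s) <= M * nrm (comb (act id) s)) ->
  exists T : H -> H', [/\ bounded_op T, (forall v, nrm (T v) <= M * nrm v)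
    & forall xi z, beta xi -> T (xi z) = Phi xi z].
Proof.
move=> M0 hM.
pose G v w := exists s, v = comb (act id) s /\ w = comb Phi s.
have combLC (H1 : hilbertType R) (Psi : (K0 -> H) -> K0 -> H1) c s s' :
    comb Psi ([seq (c * p.1, p.2) | p <- s] ++ s') =
    c *: comb Psi s + comb Psi s'.
  rewrite /comb big_cat big_map scaler_sumr; congr (_ + _).
  by apply: eq_bigr => p _; rewrite scalerA.
have Gl : linear_rel G.
  split; first by exists [::]; rewrite /comb !big_nil.
  move=> c _ _ _ _ [s [-> ->]] [s' [-> ->]].
  by exists ([seq (c * p.1, p.2) | p <- s] ++ s'); rewrite !combLC.
have Gb : bounded_rel M G by move=> _ _ [s [-> ->]].
have Gs xi z (bxi : beta xi) : G (xi z) (Phi xi z).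
  exists [:: (1, (exist _ xi bxi, z))].
  by rewrite /comb !big_seq1 !scale1r.
have Gd : dense_dom G.
  move=> v e e0; have : closed_span (op_apply beta) v by case: hb => _ ->.
  move=> /closureP/(_ _ e0)[w + vw].
  suff : lin_span (op_apply beta) `<=` [set w | exists w', G w w'].
    by move=> /[apply] -[w' Gw]; exists w, w'.
  case: Gl => G0 Gl; apply: lin_span_min; first by exists 0.
  - by move=> c u u' [w1 Gw1] [w2 Gw2]; exists (c *: w1 + w2); exact: Gl.
  - by move=> _ [xi bxi [z _ <-]]; exists (Phi xi z); exact: Gs.
have [T [bT TM hT]] := extend_rel M0 Gl Gb Gd.
by exists T; split=> // xi z bxi; exact/hT/Gs.
Qed.

Lemma module_ext {H' : hilbertType R} (S T : H -> H') :
  bounded_op S -> bounded_op T ->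
  (forall xi z, beta xi -> S (xi z) = T (xi z)) -> S = T.
Proof.
move=> bS bT h; apply: (@op_ext _ _ _ (op_apply beta)) => //; first by case: hb.
by move=> _ [xi bxi [z _ <-]]; exact: h.
Qed.

(** The chosen operator is identified with the extension and so inherits its constant: any bound for
    [x] is a bound for [rho b beta x]. *)
Lemma rho_exists x M : cb_dag b x -> 0 <= M ->
  (forall z, nrm (x z) <= M * nrm z) ->
  [/\ bounded_op (rho b beta x), (forall v, nrm (rho b beta x v) <= M * nrm v)
    & forall xi z, beta xi -> rho b beta x (xi z) = xi (x z)].
Proof.
move=> dx M0 hM.
have [T [bT TM hT]] := extend_module M0 (fun s => rho_ineq s dx M0 hM).
suff -> : rho b beta x = T by [].
rewrite /rho; case: xgetP => [S _ [bS hS]|/(_ T) []//].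
by apply: module_ext => // xi z bxi; rewrite hS// hT.
Qed.

Lemma rho_bounded x : cb_dag b x -> bounded_op (rho b beta x).
Proof.
move=> dx; have [_ [M M0 hM]] := (bounded_opP x).1 (cb_dag_bounded dx).
by have [] := rho_exists dx M0 hM.
Qed.

Lemma rhoE x xi z : cb_dag b x -> beta xi -> rho b beta x (xi z) = xi (x z).
Proof.
move=> dx; have [_ [M M0 hM]] := (bounded_opP x).1 (cb_dag_bounded dx).
by have [_ _] := rho_exists dx M0 hM; apply.
Qed.

Lemma rho_unique x (S : H -> H) : cb_dag b x -> bounded_op S ->
  (forall xi z, beta xi -> S (xi z) = xi (x z)) -> rho b beta x = S.
Proof.
move=> dx bS hS; apply: module_ext => //; first exact: rho_bounded.
by move=> xi z bxi; rewrite rhoE// hS.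
Qed.

Lemma module_inner_ext (u v : H) :
  (forall xi z, beta xi -> inner u (xi z) = inner v (xi z)) -> u = v.
Proof.
move=> h; pose G (w _ : H) := lin_span (op_apply beta) w.
apply: (@rdot_dense_ext _ _ _ G) => [w e e0|w w0].
  have : closed_span (op_apply beta) w by case: hb => _ ->.
  by move=> /closureP/(_ _ e0)[w' Yw' ww']; exists w', 0.
suff : lin_span (op_apply beta) `<=` [set w | inner u w = inner v w] by apply.
apply: lin_span_min => /=.
- by rewrite !inner0r.
- by move=> a w1 w2 h1 h2; rewrite !innerPr h1 h2.
- by move=> _ [xi bxi [z _ <-]]; exact: h.
Qed.

Lemma rho_adjoint x : cb_dag b x ->
  adjoint (rho b beta x) = rho b beta (adjoint x).
Proof.
move=> dx; have bx := rho_bounded dx; have bx' := cb_dag_bounded dx.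
apply/esym/rho_unique; [exact: cb_dag_adjoint|exact: adjoint_bounded|].
move=> xi z bxi; apply: module_inner_ext => xi' z' bxi'.
rewrite inner_adjointl// rhoE// -{1}(adjointK bx').
by rewrite -(inner_module_shift _ _ (cb_dag_adjoint dx)).
Qed.

Lemma rhoLC (a : R[i]) x y : cb_dag b x -> cb_dag b y ->
  rho b beta (a *: x + y) = a *: rho b beta x + rho b beta y.
Proof.
move=> dx dy; have [[[_ _ dl _] _ _] _] := cb_dagP b.
apply: rho_unique; first exact: dl.
  by apply: bounded_opLC; exact: rho_bounded.
by move=> xi z bxi; rewrite !fun_lcE !rhoE// (opP (module_bounded bxi)).
Qed.

(** Since [rho] is linear and contractive, a norm-closed condition on [rho b beta x] need only be
    tested on operators [x] that span [cb_dag b], such as the products [adjoint eta \o eta']. *)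
Lemma rho_preimage_subspace (V : set (H -> H)) : op_closed_subspace V ->
  op_closed_subspace [set x | cb_dag b x /\ V (rho b beta x)].
Proof.
move=> cV; apply: (@op_preimage_subspace _ _ _ _ _ _ _ id (rho b beta) 1) => //.
- by have [[]] := cb_dagP b.
- exact: rhoLC.
- exact: rho_bounded.
- by move=> x e dx e0 hx v; rewrite mul1r; have [] := rho_exists dx e0 hx.
Qed.

End Module.


(** * Ket operators and the legs of the relative tensor product *)

Section Tensor.
Context {R : realType} {b : cbase R} {H K : hilbertType R}.
Context {beta : set (cb_space b -> H)} {gamma : set (cb_space b -> K)}.
Hypotheses (hb : cmodule b beta) (hg : cmodule (cb_op b) gamma).
Variable E : rel_tensor b beta gamma.

(** The two factors enter symmetrically because [adjoint xi \o xi'] and [adjoint eta \o eta'] lie in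
    the two commuting algebras of the base. *)
Lemma inner_tens_flip eta eta' z z' xi xi' :
  gamma eta -> gamma eta' -> beta xi -> beta xi' ->
  inner (tens E xi z eta) (tens E xi' z' eta') =
  inner z (adjoint eta (eta' (adjoint xi (xi' z')))).
Proof.
move=> geta geta' bxi bxi'; rewrite inner_tens//; congr inner.
have := cb_comm (module_inner hb bxi bxi') (module_inner hg geta geta').
by move=> /(congr1 (fun f => f z')).
Qed.

Lemma tens_dense_flip : closed_span [set v | exists eta z xi,
  [/\ gamma eta, beta xi & v = tens E xi z eta]] = setT.
Proof.
rewrite -(tens_dense E); congr closed_span; apply/seteqP; split=> v.
  by move=> [eta [z [xi [? ? ->]]]]; exists xi, z, eta.
by move=> [xi [z [eta [? ? ->]]]]; exists eta, z, xi.
Qed.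

(* The flip exchanges [ket1] and [ket2], hence [left_leg] and [right_leg], up
   to conversion. *)
Definition flip_tensor : rel_tensor (cb_op b) gamma beta :=
  @RelTensor R (cb_op b) K H gamma beta (rt_space E)
    (fun eta z xi => tens E xi z eta) inner_tens_flip tens_dense_flip.

(** The squared norm of a sum of tensors [xi z eta] is the inner product of [sum xi z] with
    [sum xi (h z)], where [h = adjoint eta \o eta] lies in [cb_dag b]; [rho_ineq] for [h], with
    constant [M^2], bounds it. *)
Lemma ket2_exists eta M : gamma eta -> 0 <= M ->
  (forall z, nrm (eta z) <= M * nrm z) ->
  [/\ bounded_op (ket2 E eta), (forall v, nrm (ket2 E eta v) <= M * nrm v)
    & forall xi z, beta xi -> ket2 E eta (xi z) = tens E xi z eta].
Proof.
move=> geta M0 hM; have beta' := module_bounded hg geta.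
pose Phi xi z := tens E xi z eta.
have dh : cb_dag b (adjoint eta \o eta) := module_inner hg geta geta.
have hh z : nrm ((adjoint eta \o eta) z) <= M ^+ 2 * nrm z.
  rewrite /= (le_trans (adjoint_le beta' M0 hM _))// expr2 -mulrA.
  by rewrite ler_wpM2l.
have PhiM s : nrm (comb (beta := beta) Phi s) <=
    M * nrm (comb (fun xi z => xi z) s).
  have := rho_ineq hb s dh (sqr_ge0 M) hh.
  set X := nrm (comb (fun xi z => xi (id z)) s) => hX.
  have X0 : 0 <= X by exact: nrm_ge0.
  rewrite -(@ler_pXn2r _ 2)// ?nnegrE ?mulr_ge0 ?nrm_ge0//.
  rewrite -rdotxx /rdot [inner _ _](_ : _ =
    inner (comb (fun xi z => xi z) s)
          (comb (fun xi z => xi ((adjoint eta \o eta) z)) s)); last first.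
    apply: inner_comb => xi xi' z z' bxi bxi'.
    by rewrite inner_tens// (inner_adjoint _ _ (module_bounded hb bxi)).
  rewrite (le_trans (rdot_le _ _))// (le_trans (ler_wpM2l X0 hX))//.
  by rewrite le_eqVlt; apply/orP; left; apply/eqP; rewrite /X/=; ring.
have [T [bT TM hT]] := extend_module hb M0 PhiM.
suff -> : ket2 E eta = T by [].
rewrite /ket2; case: xgetP => [S _ [bS hS]|/(_ T) []//].
by apply: (module_ext hb) => // xi z bxi; rewrite hS// hT.
Qed.

Lemma ket2_bounded eta : gamma eta -> bounded_op (ket2 E eta).
Proof.
move=> geta; have [_ [M M0 hM]] := (bounded_opP _).1 (module_bounded hg geta).
by have [] := ket2_exists geta M0 hM.
Qed.

Lemma ket2E eta xi z : gamma eta -> beta xi ->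
  ket2 E eta (xi z) = tens E xi z eta.
Proof.
move=> geta; have [_ [M M0 hM]] := (bounded_opP _).1 (module_bounded hg geta).
by have [_ _] := ket2_exists geta M0 hM; apply.
Qed.

Lemma ket2_set_bounded : ket2 E @` gamma `<=` bounded_op.
Proof. by move=> _ [eta geta <-]; exact: ket2_bounded. Qed.

End Tensor.

(** * Kets of the first factor through the flip, and inner products of kets *)

Section TensorTheory.
Context {R : realType} {b : cbase R} {H K : hilbertType R}.
Context {beta : set (cb_space b -> H)} {gamma : set (cb_space b -> K)}.
Hypotheses (hb : cmodule b beta) (hg : cmodule (cb_op b) gamma).
Variable E : rel_tensor b beta gamma.

(** Taking the opposite base twice gives back the space and the algebra of [b] by computation, so
    lemmas on [ket2] apply to the flipped tensor product and yield those on [ket1]. *)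
Let hb' : cmodule (cb_op (cb_op b)) beta := hb.

Lemma ket1_exists xi M : beta xi -> 0 <= M ->
  (forall z, nrm (xi z) <= M * nrm z) ->
  [/\ bounded_op (ket1 E xi), (forall v, nrm (ket1 E xi v) <= M * nrm v)
    & forall eta z, gamma eta -> ket1 E xi (eta z) = tens E xi z eta].
Proof. exact: (@ket2_exists _ _ _ _ _ _ hg hb' (flip_tensor hb hg E)). Qed.

Lemma ket1_bounded xi : beta xi -> bounded_op (ket1 E xi).
Proof. exact: (@ket2_bounded _ _ _ _ _ _ hg hb' (flip_tensor hb hg E)). Qed.

Lemma ket1E xi eta z : beta xi -> gamma eta ->
  ket1 E xi (eta z) = tens E xi z eta.
Proof. exact: (@ket2E _ _ _ _ _ _ hg hb' (flip_tensor hb hg E)). Qed.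

Lemma ket1_set_bounded : ket1 E @` beta `<=` bounded_op.
Proof. exact: (@ket2_set_bounded _ _ _ _ _ _ hg hb' (flip_tensor hb hg E)). Qed.

Lemma ket1LC (a : R[i]) xi xi' : beta xi -> beta xi' ->
  ket1 E (a *: xi + xi') = a *: ket1 E xi + ket1 E xi'.
Proof.
move=> bxi bxi'; have [_ _ bl _] := module_subspace hb.
have bxi2 := bl a _ _ bxi bxi'.
apply: (module_ext hg); first exact: ket1_bounded.
  by apply: bounded_opLC; exact: ket1_bounded.
(* [tens] is not assumed linear in [xi]. Its linearity comes from
   [ket1 E xi (eta z) = ket2 E eta (xi z)], where [ket2 E eta] is a linear operator. *)
move=> eta z geta; rewrite fun_lcE !ket1E// -!(ket2E hb hg)//.
by rewrite fun_lcE (opP (ket2_bounded hb hg E geta)).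
Qed.

Lemma ket10 : ket1 E 0 = 0.
Proof.
have [_ b0 _ _] := module_subspace hb.
by have := ket1LC (-1) b0 b0; rewrite scaler0 addr0 scaleN1r addNr.
Qed.

Lemma ket1_preimage_subspace (V : set (K -> rt_space E)) :
  op_closed_subspace V ->
  op_closed_subspace [set xi | beta xi /\ V (ket1 E xi)].
Proof.
move=> cV; apply: (@op_preimage_subspace _ _ _ _ _ _ _ id (ket1 E) 1) => //.
- exact: module_subspace hb.
- exact: ket1LC.
- exact: ket1_bounded.
- by move=> xi e bxi e0 h v; rewrite mul1r; have [] := ket1_exists bxi e0 h.
Qed.

Lemma gamma_inner eta eta' : gamma eta -> gamma eta' ->
  cb_dag b (adjoint eta \o eta').
Proof. by move=> geta geta'; have := module_inner hg geta geta'. Qed.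

Lemma ket2_inner eta eta' : gamma eta -> gamma eta' ->
  adjoint (ket2 E eta) \o ket2 E eta' = rho b beta (adjoint eta \o eta').
Proof.
move=> geta geta'; have bk := ket2_bounded hb hg E.
apply/esym/(rho_unique hb); first exact: (gamma_inner geta geta').
  by apply: bounded_op_comp; [apply/adjoint_bounded|]; exact: bk.
move=> xi z bxi; apply: (module_inner_ext hb) => xi' z' bxi'.
rewrite /= inner_adjointl; last exact: bk.
rewrite !(ket2E hb hg)// inner_conj inner_tens// -inner_conj.
by rewrite (inner_adjointl _ _ (module_bounded hb bxi')).
Qed.

(** * The left leg over a base [d], later [cb_op a] or, after the flip, [c] *)

Section LeftLeg.
Variables (d : cbase R) (alpha : set (cb_space d -> H)).
Hypothesis ha : cmodule d alpha.
Hypothesis rho_alpha :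
  op_closed_span (op_mul (rho b beta @` cb_dag b) alpha) = alpha.

Local Notation left := (left_leg E alpha).

Lemma left_leg_subspace : op_closed_subspace left.
Proof. exact: op_closed_span_subspace. Qed.

Lemma left_leg_ket2 eta xi : gamma eta -> alpha xi -> left (ket2 E eta \o xi).
Proof.
move=> geta axi; apply: op_closed_span_mul => //.
- exact: ket2_set_bounded.
- exact: module_bounded ha.
Qed.

Lemma rho_comp_mem y xi : cb_dag b y -> alpha xi -> alpha (rho b beta y \o xi).
Proof.
move=> dy axi; rewrite -rho_alpha; apply: op_closed_span_mul => //.
- by move=> _ [x dx <-]; exact: rho_bounded.
- exact: module_bounded ha.
Qed.

Lemma left_leg_min (V : set (cb_space d -> rt_space E)) :
  op_closed_subspace V ->
  (forall eta xi, gamma eta -> alpha xi -> V (ket2 E eta \o xi)) ->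
  left `<=` V.
Proof.
move=> cV h; apply: op_closed_span_min => //.
by move=> _ [_ [eta geta <-] [xi axi <-]]; exact: h.
Qed.

Lemma left_leg_dense : closed_span (op_apply left) = setT.
Proof.
apply/seteqP; split=> // v _; have : setT v by []; rewrite -(tens_dense E).
apply: closed_span_min; first exact: closed_span_subspace.
move=> _ [xi [z [eta [bxi geta ->]]]]; rewrite -(ket2E hb hg)//.
(* The tensor is [ket2 E eta (xi z)], and [xi z] is approximated by combinations of vectors from
   [alpha], whose span is dense in [H]. *)
have : closed_span (op_apply alpha) (xi z) by case: ha => _ ->.
set W := closed_span (op_apply left).
apply: (@closed_span_min _ _ _ (ket2 E eta @^-1` W)).
  apply: preimage_closed_subspace; first exact: ket2_bounded.
  exact: closed_span_subspace.
move=> _ [xi' axi' [y _ <-]]; apply: sub_closed_span.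
exists (ket2 E eta \o xi'); first exact: left_leg_ket2.
by exists y.
Qed.

Lemma left_leg_mulr : op_closed_span (op_mul left (cb_alg d)) = left.
Proof.
have [[[bD _ _ _] _ _] _] := cb_algP d.
have ba := module_bounded ha.
apply/seteqP; split.
  apply: op_closed_span_min; first exact: left_leg_subspace.
  move=> _ [T lT [x dx <-]]; have bx := bD _ dx.
  apply: (op_closed_span_compr bx left_leg_subspace) lT.
  move=> _ [_ [eta geta <-] [xi axi <-]]; split.
    by apply: bounded_op_comp; [exact: ket2_bounded|exact: ba].
  exact: (left_leg_ket2 geta (module_mulr ha axi dx)).
set V := op_closed_span _; have cV : op_closed_subspace V.
  exact: op_closed_span_subspace.
apply: left_leg_min => // eta xi geta.
case: (ha) => _ _ e _; rewrite -{1}e {e}.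
apply: (@op_closed_span_compl _ _ _ _ _ _ V) => //; first exact: ket2_bounded.
move=> _ [xi' axi' [x dx <-]]; split.
  by apply: bounded_op_comp; [exact: ba|exact: bD].
apply: (@op_closed_span_mul _ _ _ _ _ _ (ket2 E eta \o xi')) => //.
- by case: left_leg_subspace.
- exact: left_leg_ket2.
Qed.

(** Products of generators are [adjoint xi \o rho b beta (adjoint eta \o eta') \o xi']. They lie in
    [cb_alg d] because [rho b beta] maps [alpha] into itself on [cb_dag b]. They exhaust it because
    [alpha] is the closed span of [rho b beta (y) alpha] and [cb_dag b] that of the products
    [adjoint eta \o eta']. *)
Lemma left_leg_inner :
  op_closed_span (op_mul (op_adjoint left) left) = cb_alg d.
Proof.
have [[cD _ _] _] := cb_algP d.
have bleft : left `<=` bounded_op by case: left_leg_subspace.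
have ba := module_bounded ha; have bk := ket2_bounded hb hg E.
have bleft' : op_adjoint left `<=` bounded_op.
  by move=> _ [T /bleft bT <-]; exact: adjoint_bounded.
apply/seteqP; split.
  apply: op_closed_span_min => // _ [_ [S lS <-] [T lT <-]].
  have bT := bleft _ lT.
  suff : [set S | bounded_op S /\ cb_alg d (adjoint S \o T)] S by case.
  move: S lS; apply: left_leg_min.
    have := adjoint_preimage_subspace (compr_preimage_subspace bT cD).
    congr op_closed_subspace; apply/seteqP; split=> S /=.
      by move=> [? []].
    by move=> [bS ?]; do 2 split => //; exact: adjoint_bounded.
  move=> eta xi geta axi; have bke := bk _ geta; have bxi := ba _ axi.
  split; first exact: bounded_op_comp.
  rewrite adjoint_comp//.
  have baxi := adjoint_bounded bxi; have bake := adjoint_bounded bke.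
  suff : [set T | bounded_op T /\
    cb_alg d ((adjoint xi \o adjoint (ket2 E eta)) \o T)] T by case.
  move: T lT {bT}; apply: left_leg_min.
    by apply: compl_preimage_subspace => //; exact: bounded_op_comp.
  move=> eta' xi' geta' axi'; split.
    by apply: bounded_op_comp; [exact: bk|exact: ba].
  have h := ket2_inner geta geta'.
  rewrite [X in cb_alg d X](_ : _ =
    adjoint xi \o (rho b beta (adjoint eta \o eta') \o xi')).
    apply: (module_inner ha axi); apply: rho_comp_mem => //.
    exact: (gamma_inner geta geta').
  by rewrite -h.
case: (ha) => _ _ _ {1}<-.
apply: op_closed_span_min; first exact: op_closed_span_subspace.
move=> _ [_ [xi axi <-] [xi' axi' <-]]; have baxi := adjoint_bounded (ba _ axi).
set V := op_closed_span _.
have cV : op_closed_subspace V by exact: op_closed_span_subspace.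
move: xi' axi'; rewrite -{1}rho_alpha.
apply: (@op_closed_span_compl _ _ _ _ _ _ V) => //.
move=> _ [_ [y dy <-] [xi' axi' <-]]; have bxi' := ba _ axi'.
split; first by apply: bounded_op_comp => //; exact: rho_bounded.
suff : [set y | cb_dag b y /\ [set T | bounded_op T /\
    V (adjoint xi \o T \o xi')] (rho b beta y)] y by move=> [_ []].
have e : op_closed_span (op_mul (op_adjoint gamma) gamma) = cb_dag b.
  by case: hg.
move: y dy; rewrite -{1}e.
apply: op_closed_span_min.
  by apply: (rho_preimage_subspace hb); exact: comp_preimage_subspace.
move=> _ [_ [eta geta <-] [eta' geta' <-]]; split.
  exact: (gamma_inner geta geta').
split; first by apply: (rho_bounded hb); exact: (gamma_inner geta geta').
rewrite -(ket2_inner geta geta').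
rewrite [X in V X](_ : _ = adjoint (ket2 E eta \o xi) \o (ket2 E eta' \o xi')).
  apply: op_closed_span_mul => //; last exact: left_leg_ket2.
  by exists (ket2 E eta \o xi) => //; exact: left_leg_ket2.
by rewrite adjoint_comp//; [exact: bk|exact: ba].
Qed.

Lemma left_leg_cmodule : cmodule d left.
Proof.
split; [exact: left_leg_subspace|exact: left_leg_dense|exact: left_leg_mulr|].
exact: left_leg_inner.
Qed.

(** Compared on vectors [xi z] with [xi] in [alpha]: there [ket2 E eta \o xi] is itself an element
    of the leg, on which [rho] acts by definition. *)
Lemma rho_left_ket2 x eta : cb_dag d x -> gamma eta ->
  rho d left x \o ket2 E eta = ket2 E eta \o rho d alpha x.
Proof.
move=> dx geta; have bk := ket2_bounded hb hg E geta.
apply: (module_ext ha).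
- by apply: bounded_op_comp => //; exact: (rho_bounded left_leg_cmodule).
- by apply: bounded_op_comp => //; exact: (rho_bounded ha).
move=> xi z axi; rewrite /= (rhoE ha)//.
exact: (rhoE left_leg_cmodule z dx (left_leg_ket2 geta axi)).
Qed.

Hypothesis rho_beta :
  op_closed_span (op_mul (rho d alpha @` cb_dag d) beta) = beta.

Lemma rho_alpha_comp_mem x xi : cb_dag d x -> beta xi ->
  beta (rho d alpha x \o xi).
Proof.
move=> dx bxi; rewrite -rho_beta; apply: op_closed_span_mul => //.
- by move=> _ [y dy <-]; exact: rho_bounded.
- exact: module_bounded hb.
Qed.

(** Since [ket1 E xi (eta z) = ket2 E eta (xi z)], this is [rho_left_ket2] read on the vectors
    [eta z]. *)
Lemma rho_left_ket1 x xi : cb_dag d x -> beta xi ->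
  rho d left x \o ket1 E xi = ket1 E (rho d alpha x \o xi).
Proof.
move=> dx bxi; have bxi' := rho_alpha_comp_mem dx bxi.
apply: (module_ext hg); last 1 first.
- move=> eta z geta; rewrite /= !ket1E// -!(ket2E hb hg)//.
  by have /(congr1 (fun f => f (xi z))) := rho_left_ket2 dx geta.
- apply: bounded_op_comp; last exact: ket1_bounded.
  exact: (rho_bounded left_leg_cmodule).
- exact: ket1_bounded.
Qed.

(** Moving [rho] through [ket1] turns the claim into one about [beta]. For the inclusion of the
    right leg in the span, [rho_beta] approximates [xi] by sums of [rho d alpha x \o xi'], and the
    contractivity of [ket1] carries the approximation over. *)
Lemma rho_left_right_leg (c : cbase R) (delta : set (cb_space c -> K)) :
  delta `<=` bounded_op ->
  op_closed_span (op_mul (rho d left @` cb_dag d) (right_leg E delta)) =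
  right_leg E delta.
Proof.
move=> bd; have bright : right_leg E delta `<=` bounded_op by move=> T [].
have cright : op_closed_subspace (right_leg E delta).
  exact: op_closed_span_subspace.
have bP x : cb_dag d x -> bounded_op (rho d left x).
  by exact: rho_bounded left_leg_cmodule _.
have bk := ket1_bounded.
have right_mem xi zeta : beta xi -> delta zeta ->
    right_leg E delta (ket1 E xi \o zeta).
  move=> bxi dzeta; apply: op_closed_span_mul => //.
  exact: ket1_set_bounded.
apply/seteqP; split.
  apply: op_closed_span_min => // _ [_ [x dx <-]] [T rT <-].
  apply: (op_closed_span_compl (bP _ dx) cright) rT.
  move=> _ [_ [xi bxi <-] [zeta dzeta <-]]; split.
    by apply: bounded_op_comp; [exact: bk|exact: bd].
  rewrite [X in right_leg _ _ X](_ : _ =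
    (rho d left x \o ket1 E xi) \o zeta)// rho_left_ket1//.
  by apply: right_mem => //; exact: rho_alpha_comp_mem.
apply: op_closed_span_min; first exact: op_closed_span_subspace.
move=> _ [_ [xi bxi <-] [zeta dzeta <-]]; set V := op_closed_span _.
have cV : op_closed_subspace V by exact: op_closed_span_subspace.
have bz := bd _ dzeta.
suff : [set xi | beta xi /\ [set T | bounded_op T /\ V (T \o zeta)]
  (ket1 E xi)] xi by move=> [_ []].
move: xi bxi; rewrite -{1}rho_beta; apply: op_closed_span_min.
  by apply: ket1_preimage_subspace; exact: compr_preimage_subspace.
move=> _ [_ [x dx <-] [xi bxi <-]]; have bxi' := rho_alpha_comp_mem dx bxi.
split=> //; split; first exact: bk.
rewrite -rho_left_ket1//.
apply: (@op_closed_span_mul _ _ _ _ _ _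
  (rho d left x) (ket1 E xi \o zeta)) => //.
- by move=> _ [y dy <-]; exact: bP.
- exact: right_mem.
Qed.

End LeftLeg.
End TensorTheory.


(** * The fiber product *)

Section FiberProduct.
Context {R : realType} {b : cbase R} {H K : hilbertType R}.
Context {beta : set (cb_space b -> H)} {gamma : set (cb_space b -> K)}.
Hypotheses (hb : cmodule b beta) (hg : cmodule (cb_op b) gamma).
Variable E : rel_tensor b beta gamma.
Variables (A : set (H -> H)) (B : set (K -> K)).

Lemma cstar_bounded {L : hilbertType R} (C : set (L -> L)) :
  cstar_algebra C -> C `<=` bounded_op.
Proof. by move=> [[]]. Qed.

Lemma cstar_mul {L : hilbertType R} (C : set (L -> L)) S T :
  cstar_algebra C -> C S -> C T -> C (S \o T).
Proof. by move=> [_ + _] CS CT; apply; exists S => //; exists T. Qed.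

Lemma cstar_adjoint {L : hilbertType R} (C : set (L -> L)) T :
  cstar_algebra C -> C T -> C (adjoint T).
Proof. by move=> [_ _ +] CT; apply; exists T. Qed.

Lemma fiber_product_flip :
  fiber_product (flip_tensor hb hg E) B A = fiber_product E A B.
Proof. by apply/seteqP; split=> T [bT h1 h2]; split. Qed.

Local Notation V2 := (op_closed_span (op_mul (ket2 E @` gamma) A)).
Local Notation V1 := (op_closed_span (op_mul (ket1 E @` beta) B)).

Lemma ket20 : ket2 E 0 = 0.
Proof.
have hb' : cmodule (cb_op (cb_op b)) beta := hb.
exact: (@ket10 _ _ _ _ _ _ hg hb' (flip_tensor hb hg E)).
Qed.

(** The definition bounds a sum of two sets. As [0] belongs to [gamma] and to [beta], and its kets
    vanish, either summand can be switched off. *)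
Lemma fiber_productP T : fiber_product E A B T <->
  [/\ bounded_op T,
    forall eta, gamma eta ->
      V2 (T \o ket2 E eta) /\ V2 (adjoint T \o ket2 E eta)
  & forall xi, beta xi ->
      V1 (T \o ket1 E xi) /\ V1 (adjoint T \o ket1 E xi)].
Proof.
have [_ b0 _ _] := module_subspace hb; have [_ g0 _ _] := module_subspace hg.
have [_ _ V2l _] := @op_closed_span_subspace _ _ _ (op_mul (ket2 E @` gamma) A).
have [_ _ V1l _] := @op_closed_span_subspace _ _ _ (op_mul (ket1 E @` beta) B).
have comp0 (L L' M : hilbertType R) (S : L -> L') : bounded_op S ->
    S \o (0 : M -> L) = 0.
  by move=> bS; apply/funext => x /=; rewrite op0.
split=> -[bT h2 h1]; have bT' := adjoint_bounded bT; split=> //.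
- move=> eta geta; split; apply: h2.
    exists (ket2 E eta); first by exists eta.
    by exists (ket2 E 0); [exists 0|rewrite ket20 comp0// addr0].
  exists (ket2 E 0); first by exists 0.
  by exists (ket2 E eta); [exists eta|rewrite ket20 comp0// add0r].
- move=> xi bxi; split; apply: h1.
    exists (ket1 E xi); first by exists xi.
    by exists (ket1 E 0); [exists 0|rewrite (ket10 hb hg) comp0// addr0].
  exists (ket1 E 0); first by exists 0.
  by exists (ket1 E xi); [exists xi|rewrite (ket10 hb hg) comp0// add0r].
- move=> _ [_ [eta geta <-] [_ [eta' geta' <-] <-]].
  rewrite -[_ \o ket2 E eta]scale1r.
  by apply: V2l; [case: (h2 _ geta)|case: (h2 _ geta')].
- move=> _ [_ [xi bxi <-] [_ [xi' bxi' <-] <-]].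
  rewrite -[_ \o ket1 E xi]scale1r.
  by apply: V1l; [case: (h1 _ bxi)|case: (h1 _ bxi')].
Qed.

End FiberProduct.

(** * Multiplication operators on a closed span [[X A]] *)

Section KetSpan.
Context {R : realType} {H K L : hilbertType R}.
Variables (X : set (H -> L)) (A : set (H -> H)).
Hypotheses (bX : X `<=` bounded_op) (bA : A `<=` bounded_op).

Local Notation V := (op_closed_span (op_mul X A)).

Lemma op_span_mull (S : L -> L) : bounded_op S ->
  (forall k a, X k -> A a -> V (S \o (k \o a))) ->
  forall T, V T -> V (S \o T).
Proof.
move=> bS h; apply: op_closed_span_compl => //.
  exact: op_closed_span_subspace.
move=> _ [k Xk [a Aa <-]]; split; last exact: h.
by apply: bounded_op_comp; [exact: bX|exact: bA].
Qed.

Lemma op_span_mulr (y : H -> H) : bounded_op y ->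
  (forall a, A a -> A (a \o y)) -> forall T, V T -> V (T \o y).
Proof.
move=> by_ h; apply: op_closed_span_compr => //.
  exact: op_closed_span_subspace.
move=> _ [k Xk [a Aa <-]]; split.
  by apply: bounded_op_comp; [exact: bX|exact: bA].
exact: (@op_closed_span_mul _ _ _ _ _ _ k (a \o y) bX bA Xk (h _ Aa)).
Qed.

(** [S k a] lies in [[X A] a], which stays in [[X A]] because [A] is closed under products; so only
    the kets [k] have to be tested. *)
Lemma op_span_mull_right (S : L -> L) : bounded_op S ->
  (forall a a', A a -> A a' -> A (a \o a')) ->
  (forall k, X k -> V (S \o k)) -> forall T, V T -> V (S \o T).
Proof.
move=> bS Amul h; apply: op_span_mull => // k a Xk Aa.
exact: (op_span_mulr (bA Aa) (fun a' Aa' => Amul _ _ Aa' Aa) (h _ Xk)).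
Qed.

End KetSpan.

(** * The fiber product is a C*-algebra, stable under the action of the base *)

Section FiberProductAlgebra.
Context {R : realType} {b : cbase R} {H K : hilbertType R}.
Context {beta : set (cb_space b -> H)} {gamma : set (cb_space b -> K)}.
Hypotheses (hb : cmodule b beta) (hg : cmodule (cb_op b) gamma).
Variable E : rel_tensor b beta gamma.
Variables (A : set (H -> H)) (B : set (K -> K)).
Hypotheses (hA : cstar_algebra A) (hB : cstar_algebra B).

Let bA := cstar_bounded hA.
Let bB := cstar_bounded hB.
Let bk2 := @ket2_set_bounded _ _ _ _ _ _ hb hg E.
Let bk1 := @ket1_set_bounded _ _ _ _ _ _ hb hg E.
Local Notation V2 := (op_closed_span (op_mul (ket2 E @` gamma) A)).
Local Notation V1 := (op_closed_span (op_mul (ket1 E @` beta) B)).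
Local Notation fiber := (fiber_product E A B).

Lemma fiber_product_bounded T : fiber T -> bounded_op T.
Proof. by case. Qed.

Lemma fiber_product_adjoint T : fiber T -> fiber (adjoint T).
Proof.
move=> /(fiber_productP hb hg)[bT h2 h1]; apply/(fiber_productP hb hg).
split; first exact: adjoint_bounded.
- by move=> eta geta; rewrite adjointK//; case: (h2 _ geta).
- by move=> xi bxi; rewrite adjointK//; case: (h1 _ bxi).
Qed.

Lemma fiber_product_span2 T S : fiber T -> V2 S -> V2 (T \o S).
Proof.
move=> /(fiber_productP hb hg)[bT h2 _]; apply: op_span_mull_right => //.
  by move=> a a'; exact: cstar_mul.
by move=> _ [eta geta <-]; case: (h2 _ geta).
Qed.

Lemma fiber_product_span1 T S : fiber T -> V1 S -> V1 (T \o S).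
Proof.
move=> /(fiber_productP hb hg)[bT _ h1]; apply: op_span_mull_right => //.
  by move=> a a'; exact: cstar_mul.
by move=> _ [xi bxi <-]; case: (h1 _ bxi).
Qed.

Lemma fiber_product_mul S T : fiber S -> fiber T -> fiber (S \o T).
Proof.
move=> fS fT; have fS' := fiber_product_adjoint fS.
have fT' := fiber_product_adjoint fT.
have bS := fiber_product_bounded fS; have bT := fiber_product_bounded fT.
have /(fiber_productP hb hg)[_ S2 S1] := fS.
have /(fiber_productP hb hg)[_ T2 T1] := fT.
apply/(fiber_productP hb hg); split; first exact: bounded_op_comp.
- move=> eta geta; rewrite adjoint_comp//; split.
    by have := fiber_product_span2 fS (T2 _ geta).1.
  by have := fiber_product_span2 fT' (S2 _ geta).2.
- move=> xi bxi; rewrite adjoint_comp//; split.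
    by have := fiber_product_span1 fS (T1 _ bxi).1.
  by have := fiber_product_span1 fT' (S1 _ bxi).2.
Qed.

(** The fiber product is an intersection, over all kets [k], of preimages of closed subspaces under
    [T |-> T \o k] and [T |-> adjoint T \o k]. *)
Lemma fiber_product_subspace : op_closed_subspace fiber.
Proof.
pose left_mul (M : hilbertType R) (k : M -> rt_space E)
  (V : set (M -> rt_space E)) : set (rt_space E -> rt_space E) :=
  [set T | bounded_op T /\ V (T \o k)].
pose left_mul2 (M : hilbertType R) (k : M -> rt_space E) V :=
  left_mul M k V `&` [set T | bounded_op T /\ left_mul M k V (adjoint T)].
have c_left_mul2 (M : hilbertType R) (k : M -> rt_space E) V :
    bounded_op k -> op_closed_subspace V ->
    op_closed_subspace (left_mul2 M k V).
  move=> bk cV; have cl := compr_preimage_subspace bk cV.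
  by apply: op_closed_subspaceI => //; exact: adjoint_preimage_subspace.
have := op_closed_subspaceI
  (op_closed_subspace_bigcap (fun eta (geta : gamma eta) => c_left_mul2 _ _ _
    (ket2_bounded hb hg E geta)
    (op_closed_span_subspace (op_mul (ket2 E @` gamma) A))))
  (op_closed_subspace_bigcap (fun xi (bxi : beta xi) => c_left_mul2 _ _ _
    (ket1_bounded hb hg E bxi)
    (op_closed_span_subspace (op_mul (ket1 E @` beta) B)))).
congr op_closed_subspace; apply/seteqP; split=> T.
  move=> [[bT h2] [_ h1]]; apply/(fiber_productP hb hg); split=> //.
    by move=> eta /h2[[_ ?] [_ [_ ?]]].
  by move=> xi /h1[[_ ?] [_ [_ ?]]].
move=> /(fiber_productP hb hg)[bT h2 h1]; have bT' := adjoint_bounded bT.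
split; split=> // k.
  by move=> /h2[? ?]; do 2 split.
by move=> /h1[? ?]; do 2 split.
Qed.

Lemma fiber_product_cstar : cstar_algebra fiber.
Proof.
split; first exact: fiber_product_subspace.
- by move=> _ [S fS [T fT <-]]; exact: fiber_product_mul.
- by move=> _ [T fT <-]; exact: fiber_product_adjoint.
Qed.

(** For [P x \o T], the operator [P x] meets generators of the spans and is absorbed by [A] or by
    [beta]. For the adjoint, [P (adjoint x)] meets a ket before [adjoint T] does: it leaves [ket2]
    on the right, where [A] must absorb it, or changes [ket1 E xi] into the ket of another element
    of [beta]. *)
Lemma fiber_product_rho_left (d : cbase R) (alpha : set (cb_space d -> H)) :
  cmodule d alpha ->
  op_closed_span (op_mul (rho b beta @` cb_dag b) alpha) = alpha ->
  op_closed_span (op_mul (rho d alpha @` cb_dag d) beta) = beta ->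
  op_mul (rho d alpha @` cb_dag d) A `<=` A ->
  op_mul (rho d (left_leg E alpha) @` cb_dag d) fiber `<=` fiber.
Proof.
move=> ha rho_alpha rho_beta rhoA _ [_ [x dx <-] [T fT <-]].
have dx' := cb_dag_adjoint dx.
have hl := left_leg_cmodule hb hg E ha rho_alpha.
have bP := rho_bounded hl dx; have bT := fiber_product_bounded fT.
set P := rho d (left_leg E alpha) in bP *.
have rk2 := rho_left_ket2 hb hg E ha rho_alpha.
have rk1 := rho_left_ket1 hb hg E ha rho_alpha rho_beta.
have A_rho a y : A a -> cb_dag d y -> A (rho d alpha y \o a).
  by move=> Aa dy; apply: rhoA; exists (rho d alpha y); [exists y|exists a].
have mem_beta y xi : cb_dag d y -> beta xi -> beta (rho d alpha y \o xi).
  exact: (rho_alpha_comp_mem hb ha rho_beta).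
(* Absorption on the right follows from absorption on the left by taking adjoints. *)
have rho_A a y : A a -> cb_dag d y -> A (a \o rho d alpha y).
  move=> Aa dy; have dy' := cb_dag_adjoint dy.
  have ba := bA Aa; have by_ := rho_bounded ha dy.
  rewrite -[X in A X]adjointK; last exact: bounded_op_comp.
  apply: (cstar_adjoint hA); rewrite adjoint_comp// (rho_adjoint ha)//.
  by apply: A_rho => //; exact: cstar_adjoint.
have fT' := fiber_product_adjoint fT.
have /(fiber_productP hb hg)[_ T2 T1] := fT.
apply/(fiber_productP hb hg); rewrite adjoint_comp// (rho_adjoint hl)//.
split; first exact: bounded_op_comp.
- move=> eta geta; split.
    have [+ _] := T2 _ geta; apply: (op_span_mull bk2 bA bP).
    move=> _ a [eta' geta' <-] Aa.
    rewrite [X in V2 X](_ : _ = (P x \o ket2 E eta') \o a)//.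
    rewrite rk2//; apply: (op_closed_span_mul bk2 bA (S := ket2 E eta')
      (T := rho d alpha x \o a)); [by exists eta'|exact: A_rho].
  rewrite -[X in V2 X]/(adjoint T \o (P (adjoint x) \o ket2 E eta)).
  rewrite rk2//.
  have [_ V2T] := T2 _ geta.
  apply: (op_span_mulr bk2 bA _ _ V2T); first exact: rho_bounded ha _ _.
  by move=> a Aa; exact: rho_A.
- move=> xi bxi; split.
    have [+ _] := T1 _ bxi; apply: (op_span_mull bk1 bB bP).
    move=> _ a [xi' bxi' <-] Ba.
    rewrite [X in V1 X](_ : _ = (P x \o ket1 E xi') \o a)//.
    rewrite rk1//; apply: op_closed_span_mul => //.
    by exists (rho d alpha x \o xi') => //; exact: mem_beta.
  rewrite -[X in V1 X]/(adjoint T \o (P (adjoint x) \o ket1 E xi)).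
  by rewrite rk1//; have [_] := T1 _ (mem_beta _ _ dx' bxi).
Qed.

End FiberProductAlgebra.

Theorem proposition3p15 (R : realType) (a b c : cbase R)
    (H K : hilbertType R)
    (alpha : set (cb_space a -> H)) (beta : set (cb_space b -> H))
    (A : set (H -> H))
    (gamma : set (cb_space b -> K)) (delta : set (cb_space c -> K))
    (B : set (K -> K))
    (hA : cbialgebra a b alpha beta A) (hB : cbialgebra b c gamma delta B)
    (E : rel_tensor b beta gamma) :
  cbialgebra a c (left_leg E alpha) (right_leg E delta) (fiber_product E A B).
Proof.
case: hA => -[ha hb rho_beta rho_alpha] cA rhoA _.
case: hB => -[hg hd rho_delta rho_gamma] cB _ rhoB.
have hb' : cmodule (cb_op (cb_op b)) beta := hb.
(* [left_leg F delta] and [right_leg E delta] are convertible, so the claims on the right leg are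
   the left-leg lemmas at [F]. *)
pose F := flip_tensor hb hg E.
have bd := module_bounded hd; have ba := module_bounded ha.
split; last 1 first.
(* Unlike for the legs, a rewrite is called for here: the flip exchanges the order of the two
   conditions in [fiber_product]. *)
- rewrite -(fiber_product_flip hb hg E A B).
  exact: (fiber_product_rho_left hg hb' (E := F) cB cA hd
    rho_delta rho_gamma rhoB).
- split.
  + exact: (left_leg_cmodule hb hg E ha rho_alpha).
  + exact: (left_leg_cmodule hg hb' F hd rho_delta).
  + exact: (rho_left_right_leg hb hg E ha rho_alpha rho_beta bd).
  + exact: (rho_left_right_leg hg hb' F hd rho_delta rho_gamma ba).
- exact: fiber_product_cstar.
- exact: (fiber_product_rho_left hb hg (E := E) cA cB ha
    rho_alpha rho_beta rhoA).
Qed.
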